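(* Let $\Delta$ and $\Gamma$ be finite simplicial graphs with $n=|V(\Delta)|$. If $\mathrm{Th}_\exists(\mathbb{G}(\Delta))\subseteq\mathrm{Th}_\exists(\mathbb{G}(\Gamma))$, then there exists a tame embedding $\varphi:\mathbb{G}(\Delta)\to\mathbb{G}(\Gamma_n)$.
   Context: $\mathbb{G}(\Gamma)=\langle V(\Gamma)\mid [x,y]=1 \text{ for } (x,y)\in E(\Gamma)\rangle$. $\mathrm{Th}_\exists(G)$ is the set of existential sentences in the language of groups true in $G$. The $n$-inflation $\Gamma_n$ has vertices $v_1,\dots,v_n$ for each $v\in V(\Gamma)$; $v_i,v_j$ adjacent for $i\ne j$, and $v_i,w_k$ ($v\ne w$) adjacent iff $(v,w)\in E(\Gamma)$. An embedding $\varphi:\mathbb{G}(\Delta)\to\mathbb{G}(\Lambda)$ is tame if for each $x_i\in V(\Delta)$, $\varphi(x_i)=y_{i1}\cdots y_{ir_i}$ where $y_{ij}=g_{ij}^{-1}x_{ij}'^{\,n_{ij}}g_{ij}$ with $x'_{ij}\in V(\Lambda)$, $n_{ij}\in\mathbb{Z}$, $g_{ij}\in\mathbb{G}(\Lambda)$, the $y_{i1},\dots,y_{ir_i}$ pairwise commute, and the conjugates $g_{ij}^{-1}x'_{ij}g_{ij}$ are pairwise distinct over all pairs $(i,j)$. *)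

(* Defs.v *)
From mathcomp Require Import all_boot ssralg ssrnum ssrint.
Set Implicit Arguments. Unset Strict Implicit. Unset Printing Implicit Defensive.

Definition simplicial_graph (V : finType) (E : rel V) : Prop :=
  symmetric E /\ irreflexive E.

Section RAAG.
Variable V : eqType.
Variable E : rel V.

(* a letter (v, b) stands for v if b = false and v^-1 if b = true *)
Definition letter := (V * bool)%type.
Definition word := seq letter.

(* defining relations of G(E) = < V | [x,y] = 1 for (x,y) in E > on words *)
Inductive rstep : word -> word -> Prop :=
| rs_free v b : rstep [:: (v, b); (v, ~~ b)] [::]
| rs_comm v w : E v w -> rstep [:: (v, false); (w, false)] [:: (w, false); (v, false)].

Inductive raag_eq : word -> word -> Prop :=
| re_step u s t w : rstep s t -> raag_eq (u ++ s ++ w) (u ++ t ++ w)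
| re_refl u : raag_eq u u
| re_sym u w : raag_eq u w -> raag_eq w u
| re_trans u w z : raag_eq u w -> raag_eq w z -> raag_eq u z.

(* group operations: product = concatenation, unit = empty word *)
Definition winv (u : word) : word := rev [seq (l.1, ~~ l.2) | l <- u].
End RAAG.

Inductive gterm : Type :=
| TVar of nat | TOne | TMul of gterm & gterm | TInv of gterm.

Inductive qformula : Type :=
| QEq of gterm & gterm
| QTrue | QFalse
| QNot of qformula
| QAnd of qformula & qformula
| QOr of qformula & qformula.

Section Semantics.
Variable V : eqType.
Variable E : rel V.

Fixpoint teval (env : nat -> word V) (t : gterm) : word V :=
  match t with
  | TVar i => env i
  | TOne => [::]
  | TMul a b => teval env a ++ teval env b
  | TInv a => winv (teval env a)
  end.

Fixpoint qsat (env : nat -> word V) (f : qformula) : Prop :=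
  match f with
  | QEq a b => raag_eq E (teval env a) (teval env b)
  | QTrue => True
  | QFalse => False
  | QNot g => ~ qsat env g
  | QAnd g h => qsat env g /\ qsat env h
  | QOr g h => qsat env g \/ qsat env h
  end.

(* the existential sentence "exists x_0 ... x_k, f" (existential closure of
   the quantifier-free formula f) holds in G(E) *)
Definition ex_holds (f : qformula) : Prop := exists env : nat -> word V, qsat env f.
End Semantics.

Definition th_ex_sub (V1 V2 : eqType) (E1 : rel V1) (E2 : rel V2) : Prop :=
  forall f : qformula, ex_holds E1 f -> ex_holds E2 f.

Definition inflation (V : finType) (E : rel V) (n : nat) : rel (V * 'I_n)%type :=
  fun p q => if p.1 == q.1 then p.2 != q.2 else E p.1 q.1.

Section Embeddings.
Variables (VD : eqType) (ED : rel VD) (VL : eqType) (EL : rel VL).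

Definition extend (phi : VD -> word VL) (u : word VD) : word VL :=
  flatten [seq (if l.2 then winv (phi l.1) else phi l.1) | l <- u].

Definition is_hom (phi : VD -> word VL) : Prop :=
  forall x y, ED x y -> raag_eq EL (phi x ++ phi y) (phi y ++ phi x).

Definition is_injective_hom (phi : VD -> word VL) : Prop :=
  forall u w, raag_eq EL (extend phi u) (extend phi w) -> raag_eq ED u w.

Definition wpow (v : VL) (k : int) : word VL := nseq `|k|%N (v, (k < 0)%R).
Definition conjw (g w : word VL) : word VL := winv g ++ w ++ g.
(* the datum (g, x', k) represents y = g^-1 x'^k g *)
Definition yword (d : word VL * VL * int) : word VL := conjw d.1.1 (wpow d.1.2 d.2).
Definition cword (d : word VL * VL * int) : word VL := conjw d.1.1 [:: (d.1.2, false)].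

Definition is_tame (phi : VD -> word VL) : Prop :=
  exists dat : VD -> seq (word VL * VL * int),
    [/\ forall x, raag_eq EL (phi x) (flatten [seq yword d | d <- dat x]),
        forall x (j1 j2 : 'I_(size (dat x))),
          raag_eq EL (yword (tnth (in_tuple (dat x)) j1) ++ yword (tnth (in_tuple (dat x)) j2))
                     (yword (tnth (in_tuple (dat x)) j2) ++ yword (tnth (in_tuple (dat x)) j1))
      & forall x1 x2 (j1 : 'I_(size (dat x1))) (j2 : 'I_(size (dat x2))),
          (x1 <> x2 \/ nat_of_ord j1 <> nat_of_ord j2) ->
          ~ raag_eq EL (cword (tnth (in_tuple (dat x1)) j1))
                       (cword (tnth (in_tuple (dat x2)) j2))].

Definition tame_embedding (phi : VD -> word VL) : Prop :=
  [/\ is_hom phi, is_injective_hom phi & is_tame phi].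
End Embeddings.

(* Main.v *)
(* An inclusion of existential theories provides, for any finite set of nontrivial
   elements of G(ED), a homomorphism psi to G(EG) that kills none of them. Write
   psi(x) as a product of commuting irreducible elements, that is, of conjugates of
   cyclically reduced elements whose support is connected in the complement graph. Then
   psi factors as G(ED) -> G(L) -> G(EG), where L is the commutation graph of these
   elements. There are finitely many possible maps G(ED) -> G(L), so psi can be chosen to
   be nontrivial on a kernel element of each of the noninjective ones; the map
   G(ED) -> G(L) that comes from psi is then injective.

   It remains to embed G(L) in G(EG_n). Two commuting irreducible elements either have
   parabolic closures that commute elementwise, or have the same parabolic closure and a
   common abelian centralizer in it. In the first case the elements may be replaced by
   generic conjugates of vertices of their supports without changing the commutation
   graph; the elements of one class of the second kind are replaced by the copies of a
   single such conjugate in the inflation. Finally, suitable powers of distinct conjugates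
   of vertices generate the right-angled Artin group of their commutation graph: passing to
   an m-fold double of the graph along the star of v, the defining graph of a subgroup of
   index m, removes the letter v from the conjugating words.

   The group theory rests on Fox derivatives with values in Z[G/<lk x>]: the support of the
   derivative of a reduced word is the set of x-hyperplanes that it crosses, each of them
   once. *)
From HB Require Import structures.
Require Import Defs.
From mathcomp Require Import boolp classical_sets filter.
From mathcomp Require Import all_boot ssralg ssrnum ssrint.
Set Implicit Arguments. Unset Strict Implicit. Unset Printing Implicit Defensive.
Import GRing.Theory Num.Theory.
Local Open Scope group_scope.
Local Open Scope classical_set_scope.

Section Commute.
Variable G : groupType.
Implicit Types x y z : G.

Lemma commuteJ x y z : commute (x ^ z) (y ^ z) <-> commute x y.
Proof.
by rewrite /commute -!conjMg; split=> [/conjg_inj|->].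
Qed.

Lemma commuteJl x y z : commute (x ^ z) y <-> commute x (y ^ z^-1).
Proof. by rewrite -{1}(conjgKV z y) commuteJ. Qed.

Lemma commute_conjg x y : commute x y -> x ^ y = x.
Proof. by move=> xy; apply/conjg_fixP/commgP. Qed.

Definition centr z : {pred G} := [pred x | x * z == z * x].

Lemma centrP x z : reflect (commute x z) (x \in centr z).
Proof. exact: eqP. Qed.

Fact centr_mulg_closed z : mulg_closed (centr z).
Proof.
move=> x y /centrP/commute_sym zx /centrP/commute_sym zy.
exact/centrP/commute_sym/commuteM.
Qed.
Fact centr1 z : 1 \in centr z.
Proof. exact/centrP/commute_sym/commute1. Qed.
Fact centr_invg_closed z : invg_closed (centr z).
Proof. by move=> x /centrP/commute_sym zx; apply/centrP/commute_sym/commuteV. Qed.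
HB.instance Definition _ z := isMulClosed.Build G (centr z) (@centr_mulg_closed z).
HB.instance Definition _ z := isMul1Closed.Build G (centr z) (centr1 z).
HB.instance Definition _ z := isInvClosed.Build G (centr z) (@centr_invg_closed z).

Lemma gmulf_inj_commute (H : groupType) (phi : UMagmaMorphism.type G H) x y :
  injective phi -> commute (phi x) (phi y) <-> commute x y.
Proof.
move=> phi_inj; split; last exact: gmulf_commute.
by rewrite /commute -!gmulfM => /phi_inj.
Qed.

End Commute.

Section ConjugatePredicate.
Variables (G : groupType) (S : groupClosed G) (k : G).

Definition conjg_pred : {pred G} := [pred x | x ^ k^-1 \in S].

Lemma conjg_predJ x : (x ^ k \in conjg_pred) = (x \in S).
Proof. by rewrite inE conjgK. Qed.

Fact conjg_pred_mulg_closed : mulg_closed conjg_pred.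
Proof. by move=> x y xS yS; rewrite inE conjMg gpredM. Qed.
Fact conjg_pred1 : 1 \in conjg_pred.
Proof. by rewrite inE conj1g gpred1. Qed.
Fact conjg_pred_invg_closed : invg_closed conjg_pred.
Proof. by move=> x xS; rewrite inE conjVg gpredV. Qed.
HB.instance Definition _ := isMulClosed.Build G conjg_pred conjg_pred_mulg_closed.
HB.instance Definition _ := isMul1Closed.Build G conjg_pred conjg_pred1.
HB.instance Definition _ := isInvClosed.Build G conjg_pred conjg_pred_invg_closed.

End ConjugatePredicate.

Record sgraph (V : Type) := SGraph {
  adj :> rel V;
  adj_sym : symmetric adj;
  adj_irr : irreflexive adj }.

Section CommutationGraph.
Variables (I : eqType) (G : groupType) (c : I -> G).

Definition commgraph_adj : rel I := fun i j => (i != j) && (c i \in centr (c j)).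

Lemma commgraph_adjP i j : reflect (i <> j /\ commute (c i) (c j)) (commgraph_adj i j).
Proof. by apply: (iffP andP) => -[/eqP ij /centrP cij]. Qed.

Lemma commgraph_adj_sym : symmetric commgraph_adj.
Proof.
by move=> i j; rewrite /commgraph_adj eq_sym; congr (_ && _);
  apply/centrP/centrP; apply: commute_sym.
Qed.

Lemma commgraph_adj_irr : irreflexive commgraph_adj.
Proof. by move=> i; rewrite /commgraph_adj eqxx. Qed.

Definition commgraph : sgraph I := SGraph commgraph_adj_sym commgraph_adj_irr.

End CommutationGraph.

(** * Right-angled Artin groups *)

Section Words.
Variable V : eqType.
Implicit Types (u w : word V) (l : letter V) (E : rel V) (Y : pred V).

Lemma winvK : involutive (@winv V).
Proof.
move=> u; rewrite /winv map_rev revK -map_comp map_id_in // => -[v b] _ /=.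
by rewrite negbK.
Qed.

Lemma winv_cat u w : winv (u ++ w) = winv w ++ winv u.
Proof. by rewrite /winv map_cat rev_cat. Qed.

Lemma raag_eq_infix E u w a b : raag_eq E a b -> raag_eq E (u ++ a ++ w) (u ++ b ++ w).
Proof.
elim=> {a b} [a s t b st|a|a b _ IH|a b c _ IH _ IH'].
- rewrite -!catA !(catA u); exact: re_step.
- exact: re_refl.
- exact: re_sym.
- exact: re_trans IH IH'.
Qed.

Lemma raag_eq_cat E u u' w w' :
  raag_eq E u u' -> raag_eq E w w' -> raag_eq E (u ++ w) (u' ++ w').
Proof.
move=> uu' /(raag_eq_infix u' [::]); rewrite !cats0; apply: re_trans.
exact: (@raag_eq_infix E [::] w _ _ uu').
Qed.

Lemma raag_eq_winvl E u : raag_eq E (winv u ++ u) [::].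
Proof.
elim: u => [|[v b] u IH]; first exact: re_refl.
apply: re_trans IH; rewrite /winv map_cons rev_cons cat_rcons /=.
have := @re_step _ E (winv u) [:: (v, ~~ b); (v, b)] [::] u.
by rewrite -{2}[b]negbK; apply; apply: rs_free.
Qed.

Lemma raag_eq_winvr E u : raag_eq E (u ++ winv u) [::].
Proof. by rewrite -{1}[u]winvK; apply: raag_eq_winvl. Qed.

Lemma raag_eq_winv E u w : raag_eq E u w -> raag_eq E (winv u) (winv w).
Proof.
move=> uw; apply: (@re_trans _ _ _ (winv u ++ (w ++ winv w))).
  rewrite -{1}[winv u]cats0; apply: raag_eq_cat; first exact: re_refl.
  exact/re_sym/raag_eq_winvr.
rewrite catA -{2}[winv w]cat0s; apply: raag_eq_cat; last exact: re_refl.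
apply: re_trans (raag_eq_winvl _ u).
by apply: raag_eq_cat; [apply: re_refl | apply: re_sym].
Qed.

Definition supp w : seq V := unzip1 w.
Definition wfilter Y w : word V := [seq l <- w | Y l.1].

Lemma supp_cat u w : supp (u ++ w) = supp u ++ supp w.
Proof. exact: map_cat. Qed.

Lemma size_supp w : size (supp w) = size w.
Proof. exact: size_map. Qed.

Lemma supp_wfilter Y w : supp (wfilter Y w) = [seq v <- supp w | Y v].
Proof. by rewrite /supp /unzip1 filter_map. Qed.

Lemma count_supp_winv x w : count_mem x (supp (winv w)) = count_mem x (supp w).
Proof. by rewrite /supp /unzip1 /winv map_rev count_rev -map_comp. Qed.

Lemma supp_neq_nil w : w != [::] -> exists x, x \in supp w.
Proof. by case: w => // l w _; exists l.1; apply: mem_head. Qed.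

Lemma supp_letter x w : x \in supp w -> exists b, (x, b) \in w.
Proof. by move=> /mapP[[y b] lw ->]; exists b. Qed.

Lemma all_supp Y w : all Y (supp w) -> wfilter Y w = w.
Proof. by rewrite all_map => /all_filterP. Qed.

End Words.

Section Group.
Variables (V : choiceType) (E : rel V).
Implicit Types (u w : word V) (v : V) (l : letter V).

Definition raag_eqb : rel (word V) := fun u w => `[< raag_eq E u w >].

Lemma raag_eqb_equiv : equiv_class_of raag_eqb.
Proof.
split=> [u|u w|u w z]; first exact/asboolP/re_refl.
- by apply/asboolP/asboolP; apply: re_sym.
- by move=> /asboolP uw /asboolP wz; apply/asboolP; apply: re_trans uw wz.
Qed.
Canonical raag_equiv := EquivRelPack raag_eqb_equiv.

Definition raag := {eq_quot raag_equiv}%qT.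
HB.instance Definition _ := Choice.on raag.

Definition wval w : raag := (\pi_raag w)%qT.
Definition wrepr (g : raag) : word V := repr g.

Lemma wreprK : cancel wrepr wval.
Proof. exact: reprK. Qed.

Lemma wvalP u w : wval u = wval w <-> raag_eq E u w.
Proof. by split=> [/eqmodP/asboolP|uw]; last exact/eqmodP/asboolP. Qed.

Lemma raag_eq_wrepr w : raag_eq E (wrepr (wval w)) w.
Proof. by apply/wvalP; rewrite wreprK. Qed.

Definition raag_mul (g h : raag) := wval (wrepr g ++ wrepr h).
Definition raag_inv (g : raag) := wval (winv (wrepr g)).
Definition raag_one : raag := wval [::].

Lemma raag_mulE u w : raag_mul (wval u) (wval w) = wval (u ++ w).
Proof. by apply/wvalP/raag_eq_cat; apply: raag_eq_wrepr. Qed.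

Lemma raag_invE u : raag_inv (wval u) = wval (winv u).
Proof. exact/wvalP/raag_eq_winv/raag_eq_wrepr. Qed.

Lemma raag_mulA : associative raag_mul.
Proof.
by move=> g h k; rewrite -(wreprK g) -(wreprK h) -(wreprK k) !raag_mulE catA.
Qed.

Lemma raag_mul1g : left_id raag_one raag_mul.
Proof. by move=> g; rewrite -(wreprK g) raag_mulE. Qed.

Lemma raag_mulg1 : right_id raag_one raag_mul.
Proof. by move=> g; rewrite -(wreprK g) raag_mulE cats0. Qed.

Lemma raag_mulVg : left_inverse raag_one raag_inv raag_mul.
Proof.
by move=> g; rewrite -(wreprK g) raag_invE raag_mulE; apply/wvalP/raag_eq_winvl.
Qed.

Lemma raag_mulgV : right_inverse raag_one raag_inv raag_mul.
Proof.
by move=> g; rewrite -(wreprK g) raag_invE raag_mulE; apply/wvalP/raag_eq_winvr.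
Qed.

HB.instance Definition _ := isGroup.Build raag
  raag_mulA raag_mul1g raag_mulg1 raag_mulVg raag_mulgV.

Definition gen v : raag := wval [:: (v, false)].
Definition lval l : raag := if l.2 then (gen l.1)^-1 else gen l.1.

Lemma wval0 : wval [::] = 1. Proof. by []. Qed.

Lemma wval_cat u w : wval (u ++ w) = wval u * wval w.
Proof. by rewrite -raag_mulE. Qed.

Lemma wval_winv u : wval (winv u) = (wval u)^-1.
Proof. by rewrite -raag_invE. Qed.

Lemma wval1 l : wval [:: l] = lval l.
Proof. by case: l => v []; rewrite /lval //= /gen -wval_winv. Qed.

Lemma wval_cons l w : wval (l :: w) = lval l * wval w.
Proof. by rewrite -cat1s wval_cat wval1. Qed.

Lemma wval_rcons l w : wval (rcons w l) = wval w * lval l.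
Proof. by rewrite -cats1 wval_cat wval1. Qed.

Lemma wval_nseq n v : wval (nseq n (v, false)) = gen v ^+ n.
Proof. by elim: n => [|n IH]; rewrite //= wval_cons IH expgS. Qed.

Lemma lvalN v b : lval (v, ~~ b) = (lval (v, b))^-1.
Proof. by case: b; rewrite /lval /= ?invgK. Qed.

Lemma gen_commute v v' : E v v' -> commute (gen v) (gen v').
Proof.
move=> vv'; rewrite /commute /gen -!wval_cat; apply/wvalP.
exact: (@re_step _ E [::] _ _ [::] (rs_comm vv')).
Qed.

Lemma lval_closed (S : groupClosed raag) l : gen l.1 \in S -> lval l \in S.
Proof. by case: l => v []; rewrite /lval //= gpredV. Qed.

Lemma wval_closed (S : groupClosed raag) w :
  {in supp w, forall v, gen v \in S} -> wval w \in S.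
Proof.
elim: w => [|l w IH] Sw; first exact: gpred1.
rewrite wval_cons gpredM ?lval_closed ?Sw ?mem_head //.
by apply: IH => v vw; apply: Sw; rewrite inE vw orbT.
Qed.

End Group.
Bind Scope group_scope with raag.

Section Lift.
Variables (V : choiceType) (H : groupType).
Implicit Types (E : rel V) (f : V -> H) (u w : word V).

Definition weval f w : H := \prod_(l <- w) (if l.2 then (f l.1)^-1 else f l.1).

Lemma weval0 f : weval f [::] = 1.
Proof. exact: big_nil. Qed.

Lemma weval_cat f u w : weval f (u ++ w) = weval f u * weval f w.
Proof. exact: big_cat. Qed.

Lemma weval_cons f l w :
  weval f (l :: w) = (if l.2 then (f l.1)^-1 else f l.1) * weval f w.
Proof. exact: big_cons. Qed.

Lemma weval_winv f w : weval f (winv w) = (weval f w)^-1.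
Proof.
elim: w => [|[v b] w IH]; first by rewrite weval0 invg1.
rewrite -cat1s winv_cat !weval_cat IH invgM; congr (_ * _).
by rewrite /weval /= !big_seq1; case: b => //=; rewrite invgK.
Qed.

Lemma eq_weval f f' : f =1 f' -> weval f =1 weval f'.
Proof. by move=> ff' w; apply: eq_bigr => l _; rewrite ff'. Qed.

Definition edge_commute E f := forall x y, E x y -> commute (f x) (f y).

Section Morphism.
Variables (E : rel V) (f : V -> H) (fC : edge_commute E f).
Implicit Types g h : raag E.

Lemma weval_raag_eq u w : raag_eq E u w -> weval f u = weval f w.
Proof.
elim=> {u w} [a s t b st|a|a b _ ->|a b d _ -> _ ->] //.
rewrite !weval_cat; congr (_ * (_ * _)); case: st => [v c|v w /fC vw].
  by rewrite !weval_cons weval0 mulg1; case: c; rewrite /= ?mulVg ?mulgV.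
by rewrite !weval_cons weval0 /= !mulg1.
Qed.

Definition raag_lift of edge_commute E f := fun g => weval f (wrepr g).
Local Notation lift := (raag_lift fC).

Lemma raag_lift_wval w : lift (wval E w) = weval f w.
Proof. exact/weval_raag_eq/raag_eq_wrepr. Qed.

Lemma raag_lift_gen v : lift (gen E v) = f v.
Proof. by rewrite raag_lift_wval weval_cons weval0 mulg1. Qed.

Fact raag_liftF : {morph lift : g h / g / h}.
Proof.
move=> g h; rewrite -(wreprK g) -(wreprK h) -wval_winv -wval_cat !raag_lift_wval.
by rewrite weval_cat weval_winv.
Qed.
HB.instance Definition _ := isGroupMorphism.Build (raag E) H lift raag_liftF.

End Morphism.
End Lift.

Lemma weval_gen (V : choiceType) (E : rel V) w : weval (gen E) w = wval E w.
Proof. by elim: w => [|l w IH]; rewrite ?weval0 // weval_cons IH wval_cons. Qed.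

Lemma weval_morph (V : choiceType) (G H : groupType) (f : V -> G)
    (phi : UMagmaMorphism.type G H) w :
  weval (phi \o f) w = phi (weval f w).
Proof.
rewrite /weval gmulf_prod; apply: eq_bigr => l _.
by case: l.2; rewrite /= ?gmulfV.
Qed.

Lemma eq_raag_morphism (V : choiceType) (E : rel V) (H : groupType)
    (phi psi : UMagmaMorphism.type (raag E) H) :
  (forall v, phi (gen E v) = psi (gen E v)) -> phi =1 psi.
Proof.
move=> eq_gen g; rewrite -(wreprK g) -(weval_gen E) -!weval_morph.
exact: eq_weval.
Qed.

Section Action.
Variables (V : choiceType) (E : rel V) (T : Type) (step : T -> letter V -> T).
Hypothesis stepK : forall v b t, step (step t (v, b)) (v, ~~ b) = t.
Hypothesis stepC : forall v w t, E v w ->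
  step (step t (v, false)) (w, false) = step (step t (w, false)) (v, false).

Lemma foldl_raag_eq t u w : raag_eq E u w -> foldl step t u = foldl step t w.
Proof.
move=> uw; elim: uw t => {u w} [a u u' b uu'|a|a b _ IH|a b c _ IH _ IH'] t //.
  rewrite !foldl_cat; congr foldl; move: (foldl _ _ a) => {}t.
  by case: uu' => [v c|v w vw] /=; [rewrite stepK | rewrite stepC].
by rewrite IH.
Qed.

Definition raag_act (t : T) (g : raag E) : T := foldl step t (wrepr g).

Lemma raag_act_wval t w : raag_act t (wval E w) = foldl step t w.
Proof. exact/foldl_raag_eq/raag_eq_wrepr. Qed.

Lemma raag_act1 t : raag_act t 1 = t.
Proof. by rewrite -wval0 raag_act_wval. Qed.

Lemma raag_actM t g h : raag_act t (g * h) = raag_act (raag_act t g) h.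
Proof.
by rewrite -(wreprK g) -(wreprK h) -wval_cat !raag_act_wval foldl_cat.
Qed.

Lemma raag_act_gen t v : raag_act t (gen E v) = step t (v, false).
Proof. exact: raag_act_wval. Qed.

Lemma raag_actV t t' g : raag_act t g = t' -> raag_act t' g^-1 = t.
Proof. by move=> <-; rewrite -raag_actM mulgV raag_act1. Qed.

End Action.

Section Parabolic.
Variables (V : choiceType) (E : rel V).
Implicit Types (Y Z : pred V) (g h : raag E) (w : word V).

Fact retr_edge_commute Y : edge_commute E (fun v => if Y v then gen E v else 1).
Proof.
move=> v w vw; case: ifP => _; last exact/commute_sym/commute1.
by case: ifP => _; [apply: gen_commute | apply: commute1].
Qed.

Definition retr Y : raag E -> raag E := raag_lift (retr_edge_commute Y).
HB.instance Definition _ Y :=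
  UMagmaMorphism.copy (retr Y) (raag_lift (retr_edge_commute Y)).

Lemma retr_wval Y w : retr Y (wval E w) = wval E (wfilter Y w).
Proof.
rewrite /retr raag_lift_wval; elim: w => [|[v b] w IH]; first by rewrite weval0.
rewrite weval_cons IH /=; case: (Y v); first by rewrite wval_cons.
by case: b; rewrite ?invg1 mul1g.
Qed.

(* The subgroup generated by the vertices in Y. *)
Definition parab Y : {pred raag E} := [pred g | retr Y g == g].

Lemma parabP Y g : reflect (retr Y g = g) (g \in parab Y).
Proof. exact: eqP. Qed.

Fact parab_mulg_closed Y : mulg_closed (parab Y).
Proof. by move=> g h /parabP Yg /parabP Yh; apply/parabP; rewrite gmulfM/= Yg Yh. Qed.
Fact parab1 Y : 1 \in parab Y.
Proof. by apply/parabP; rewrite gmulf1. Qed.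
Fact parab_invg_closed Y : invg_closed (parab Y).
Proof. by move=> g /parabP Yg; apply/parabP; rewrite gmulfV/= Yg. Qed.
HB.instance Definition _ Y :=
  isMulClosed.Build (raag E) (parab Y) (@parab_mulg_closed Y).
HB.instance Definition _ Y := isMul1Closed.Build (raag E) (parab Y) (parab1 Y).
HB.instance Definition _ Y :=
  isInvClosed.Build (raag E) (parab Y) (@parab_invg_closed Y).

Lemma retr_parab Y g : retr Y g \in parab Y.
Proof.
rewrite -(wreprK g); apply/parabP; rewrite !retr_wval /wfilter.
by rewrite -filter_predI; congr wval; apply: eq_filter => l /=; rewrite andbb.
Qed.

Lemma wval_parab Y w : all Y (supp w) -> wval E w \in parab Y.
Proof. by move=> Yw; apply/parabP; rewrite retr_wval all_supp. Qed.

Lemma parab_supp w : wval E w \in parab (mem (supp w)).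
Proof. by apply: wval_parab; apply/allP. Qed.

Lemma gen_parab Y v : Y v -> gen E v \in parab Y.
Proof. by move=> Yv; apply: wval_parab; rewrite /= Yv. Qed.

Lemma parab_word Y g : g \in parab Y -> exists2 w, g = wval E w & all Y (supp w).
Proof.
move=> /parabP <-; exists (wfilter Y (wrepr g)).
  by rewrite -retr_wval wreprK.
by rewrite supp_wfilter filter_all.
Qed.

Lemma sub_parab (S : groupClosed (raag E)) Y :
  (forall v, Y v -> gen E v \in S) -> {subset parab Y <= S}.
Proof.
by move=> YS g /parab_word[w -> /allP Yw]; apply: wval_closed => v /Yw/YS.
Qed.

Lemma parabS Y Z : {subset Y <= Z} -> {subset parab Y <= parab Z}.
Proof. by move=> YZ; apply: sub_parab => v /YZ; apply: gen_parab. Qed.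

Lemma parab_gen_commute Y g h : (forall v, Y v -> commute (gen E v) h) ->
  g \in parab Y -> commute g h.
Proof. by move=> Yh /(sub_parab (S := centr h)) c; apply/centrP/c => v /Yh/centrP. Qed.

Definition joined Y Z := forall y z, Y y -> Z z -> E y z.

Lemma parab_commute Y Z g h : joined Y Z ->
  g \in parab Y -> h \in parab Z -> commute g h.
Proof.
move=> YZ Yg Zh; apply: parab_gen_commute Yg => y Yy; apply: commute_sym.
by apply: parab_gen_commute Zh => z Zz; apply/commute_sym/gen_commute/YZ.
Qed.

End Parabolic.

Lemma pigeonhole_seq (T : eqType) (f : nat -> T) (s : seq T) :
  (forall n, f n \in s) -> exists m n, m < n /\ f m = f n.
Proof.
move=> fs; have /(uniqPn (f 0)) : ~~ uniq (mkseq f (size s).+1).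
  apply/negP => uf; have := uniq_leq_size uf (s2 := s).
  by rewrite size_mkseq ltnn => H; have : false by apply: H => _ /mapP[n _ ->].
move=> [i [j [ij]]]; rewrite size_mkseq => js.
by rewrite !nth_mkseq ?(ltn_trans ij) //; exists i, j.
Qed.

(** * Hyperplanes and Fox derivatives *)

Section Integral.
Variables (V : choiceType) (E : sgraph V) (x : V).
Implicit Types (g h k : raag E) (u v w : word V) (l : letter V) (A : raag E -> int).

Definition crossing h l : raag E := if l.2 then h * (gen E x)^-1 else h.

(* The edges (k, k x) of the Cayley graph on the path spelled by w from h, each
   with a Boolean that is true if the path goes from k x to k. *)
Fixpoint crossings h w : seq (raag E * bool) :=
  if w is l :: w' then
    (if l.1 == x then [:: (crossing h l, l.2)] else [::]) ++ crossings (h * lval E l) w'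
  else [::].

Lemma crossings_cat h u w :
  crossings h (u ++ w) = crossings h u ++ crossings (h * wval E u) w.
Proof.
elim: u h => [|l u IH] h /=; first by rewrite wval0 mulg1.
by rewrite IH -catA wval_cons mulgA.
Qed.

Lemma crossingsM g h w :
  crossings (g * h) w = [seq (g * e.1, e.2) | e <- crossings h w].
Proof.
elim: w h => [|l w IH] h //=.
rewrite map_cat -mulgA IH; congr (_ ++ _).
by case: (l.1 == x) => //=; rewrite /crossing; case: l.2; rewrite /= ?mulgA.
Qed.

Lemma size_crossings h w : size (crossings h w) = count_mem x (supp w).
Proof. by elim: w h => [|l w IH] h //=; rewrite size_cat IH; case: (l.1 == x). Qed.

Lemma crossings_nil h w : x \notin supp w -> crossings h w = [::].
Proof. by move=> xw; apply/nilP; rewrite /nilp size_crossings (count_memPn xw). Qed.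

Lemma crossings_neq_nil h w : x \in supp w -> exists e, e \in crossings h w.
Proof.
rewrite -has_pred1 has_count -(size_crossings h).
by case: (crossings h w) => // e s _; exists e; apply: mem_head.
Qed.

Definition orientation (b : bool) : int := if b then (-1)%R else 1%R.

(* The integral along the path spelled by w from h of the 1-form on the Cayley graph
   with value [A k] on each edge (k, k x) and 0 on the edges of the other generators;
   invariance under <lk x> makes this form closed. *)
Definition integral A h w : int :=
  (\sum_(e <- crossings h w) orientation e.2 * A e.1)%R.

Lemma integral_cat A h u w :
  integral A h (u ++ w) = (integral A h u + integral A (h * wval E u) w)%R.
Proof. by rewrite /integral crossings_cat big_cat. Qed.

Lemma integralM A g h w :
  integral A (g * h) w = integral (fun k => A (g * k)) h w.
Proof. by rewrite /integral crossingsM big_map. Qed.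

Lemma integral_cons A h l w : integral A h (l :: w) =
  ((if l.1 == x then orientation l.2 * A (crossing h l) else 0)
     + integral A (h * lval E l) w)%R.
Proof.
by rewrite /integral /= big_cat /=; case: ifP; rewrite ?big_seq1 ?big_nil.
Qed.

Lemma integral_nil A h : integral A h [::] = 0%R.
Proof. exact: big_nil. Qed.

Definition lk_invariant A := forall k h, h \in parab (adj E x) -> A (k * h) = A k.

Lemma integral_rstep A h s t :
  lk_invariant A -> rstep E s t -> integral A h s = integral A h t.
Proof.
move=> Ainv [v b|v w vw]; rewrite !integral_cons !integral_nil !addr0 /=.
  case: eqP => [->|//]; rewrite /orientation /crossing /lval; case: b => /=.
    by rewrite mulN1r mul1r addNr.
  by rewrite mulgK mul1r mulN1r addrN.
rewrite /crossing /lval /=; case: (eqVneq v x) vw => [->|_] xw.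
  case: eqP xw => [->|_ xw]; first by rewrite adj_irr.
  by rewrite addr0 add0r Ainv ?gen_parab.
rewrite addr0 add0r; case: eqP xw => // -> xv.
by rewrite Ainv // gen_parab // adj_sym.
Qed.

Lemma integral_raag_eq A h u w :
  lk_invariant A -> raag_eq E u w -> integral A h u = integral A h w.
Proof.
move=> Ainv uw; elim: uw h => {u w} [a s t b st|a|a b _ IH|a b c _ IH _ IH'] h //.
  have st_eq : wval E s = wval E t.
    by apply/wvalP; have := @re_step _ E [::] _ _ [::] st; rewrite /= !cats0.
  by rewrite !integral_cat st_eq (integral_rstep _ Ainv st).
by rewrite IH.
Qed.

(* The integral of the constant 1 is the exponent sum of x. *)
Lemma genX_neq1 n : 0 < n -> gen E x ^+ n != 1.
Proof.
have sumE h : integral (fun=> 1%R) h (nseq n (x, false)) = n%:R%R.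
  elim: n h => [|n IH] h; first by rewrite integral_nil.
  by rewrite integral_cons IH /= eqxx mulr1 -natr1 addrC.
move=> n0; apply/eqP; rewrite -wval_nseq -wval0.
move=> /wvalP/(integral_raag_eq (A := fun=> 1%R) 1)-/(_ (fun _ _ _ => erefl)).
by rewrite sumE integral_nil => /eqP; rewrite pnatr_eq0 -leqn0 leqNgt n0.
Qed.

(* A canonical element of the coset h <lk x>, which is the set of the initial
   vertices of the edges dual to one hyperplane. *)
Definition hyperplane h := choose (fun k => h^-1 * k \in parab (adj E x)) h.

Lemma hyperplaneP h k :
  reflect (hyperplane h = hyperplane k) (h^-1 * k \in parab (adj E x)).
Proof.
have telescope (a b c : raag E) : a^-1 * c = a^-1 * b * (b^-1 * c).
  by rewrite mulgA mulgK.
have refl g : g^-1 * g \in parab (adj E x) by rewrite mulVg gpred1.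
have hypP g : g^-1 * hyperplane g \in parab (adj E x).
  exact: (@chooseP _ (fun k => g^-1 * k \in _) g (refl g)).
apply: (iffP idP) => [hk|e]; last first.
  rewrite (telescope _ (hyperplane k)); apply: gpredM; first by rewrite -e.
  by rewrite -gpredV invgM invgK.
rewrite /hyperplane (@eq_choose _ _ (fun g => k^-1 * g \in parab (adj E x))).
  by apply: choose_id => //; rewrite -gpredV invgM invgK.
by move=> g; rewrite (telescope h k) gpredMl.
Qed.

Lemma hyperplaneMl g h k :
  (hyperplane (g * h) == hyperplane (g * k)) = (hyperplane h == hyperplane k).
Proof.
by apply/eqP/eqP => /hyperplaneP H; apply/hyperplaneP; move: H;
  rewrite invgM -mulgA mulKg.
Qed.

Lemma hyperplaneMr h k : k \in parab (adj E x) -> hyperplane (h * k) = hyperplane h.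
Proof. by move=> xk; apply/esym/hyperplaneP; rewrite mulKg. Qed.

Definition delta k h : int := (hyperplane h == hyperplane k)%:R%R.

Lemma delta_invariant k : lk_invariant (delta k).
Proof. by move=> h g xg; rewrite /delta hyperplaneMr. Qed.

(* The coefficient of the coset k <lk x> in the Fox derivative of g with respect to
   x, with values in the permutation module Z[G/<lk x>]. *)
Definition fox g k : int := integral (delta k) 1 (wrepr g).

Lemma fox_wval w k : fox (wval E w) k = integral (delta k) 1 w.
Proof. exact/integral_raag_eq/raag_eq_wrepr/delta_invariant. Qed.

Lemma foxM g h k : fox (g * h) k = (fox g k + fox h (g^-1 * k))%R.
Proof.
rewrite -(wreprK g) -(wreprK h) -wval_cat !fox_wval integral_cat; congr (_ + _)%R.
rewrite mul1g -{1}[wval E (wrepr g)]mulg1 integralM.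
apply: eq_bigr => e _; rewrite /delta.
by rewrite -(hyperplaneMl (wval E (wrepr g))^-1) mulKg.
Qed.

Lemma fox_hyperplane g h k : hyperplane h = hyperplane k -> fox g h = fox g k.
Proof. by move=> hk; apply: eq_bigr => e _; rewrite /delta hk. Qed.

Lemma fox_parab g k : g \in parab (predC1 x) -> fox g k = 0%R.
Proof.
move=> /parab_word[w -> xw]; rewrite fox_wval /integral crossings_nil ?big_nil //.
by rewrite -has_pred1 -all_predC.
Qed.

Lemma fox_translate g h t k : g \in parab (predC1 x) -> h \in parab (predC1 x) ->
  g * t = t * h -> fox t (g^-1 * k) = fox t k.
Proof.
move=> xg xh gt; have := foxM t h k; rewrite -gt foxM.
by rewrite fox_parab // (fox_parab _ xh) add0r addr0.
Qed.

Definition hyperplanes h w := [seq hyperplane e.1 | e <- crossings h w].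

Lemma size_hyperplanes h w : size (hyperplanes h w) = count_mem x (supp w).
Proof. by rewrite size_map size_crossings. Qed.

Lemma hyperplanes_cat h u w :
  hyperplanes h (u ++ w) = hyperplanes h u ++ hyperplanes (h * wval E u) w.
Proof. by rewrite /hyperplanes crossings_cat map_cat. Qed.

Lemma fox_notin w k : hyperplane k \notin hyperplanes 1 w -> fox (wval E w) k = 0%R.
Proof.
move=> kw; rewrite fox_wval /integral big_seq big1 // => e ew; rewrite /delta.
case: eqP => [ek|_]; last by rewrite mulr0.
by case/negP: kw; rewrite -ek; apply/mapP; exists e.
Qed.

(* Finitely many hyperplanes meet t, and g permutes them. *)
Lemma fox_stabilizer g h t k : g \in parab (predC1 x) -> h \in parab (predC1 x) ->
  g * t = t * h -> fox t k != 0%R ->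
  exists2 n, 0 < n & (g ^+ n) ^ k \in parab (adj E x).
Proof.
move=> xg xh gt tk.
have gtX m : g ^+ m * t = t * h ^+ m.
  elim: m => [|m IH]; first by rewrite mul1g mulg1.
  by rewrite expgS -mulgA IH mulgA gt -mulgA -expgS.
have [m|m [n [mn]]] := @pigeonhole_seq _ (fun m => hyperplane (g ^- m * k))
    (hyperplanes 1 (wrepr t)).
  apply: contraT => /fox_notin; rewrite wreprK (fox_translate _ _ _ (gtX m)) ?gpredXn //.
  by move=> tk0; rewrite tk0 eqxx in tk.
move=> /esym/hyperplaneP; rewrite invgM invgK -(subnK (ltnW mn)) expgnDr.
rewrite !mulgA mulgK -[X in X \in _]mulgA -/(g ^+ _ ^ k).
by exists (n - m)%N; rewrite ?subn_gt0.
Qed.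

Definition crosses_once w := uniq (hyperplanes 1 w).

Lemma uniq_hyperplanes h w : uniq (hyperplanes h w) = crosses_once w.
Proof.
rewrite /crosses_once /hyperplanes -[h]mulg1 crossingsM -map_comp.
elim: (crossings 1 w) => //= e s ->; congr (~~ _ && _).
by elim: s => //= e' s IH; rewrite !inE IH hyperplaneMl.
Qed.

Lemma crosses_once_infix u w v : crosses_once (u ++ w ++ v) -> crosses_once w.
Proof.
rewrite /crosses_once !hyperplanes_cat !cat_uniq => /and3P[_ _ /andP[]].
by rewrite uniq_hyperplanes.
Qed.

Lemma fox_crossing w e : crosses_once w -> e \in crossings 1 w ->
  fox (wval E w) e.1 = orientation e.2.
Proof.
rewrite fox_wval /integral /crosses_once /hyperplanes.
elim: (crossings 1 w) => //= f s IH /andP[fs us].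
rewrite inE big_cons /delta => /orP[/eqP ->|es].
  rewrite eqxx mulr1 big_seq big1 ?addr0 // => e' e's.
  case: eqP => [ee'|_]; last by rewrite mulr0.
  by case/negP: fs; rewrite -ee'; apply/mapP; exists e'.
case: eqP => [fe|_]; last by rewrite mulr0 add0r IH.
by case/negP: fs; rewrite fe; apply/mapP; exists e.
Qed.

Lemma fox_neq0 w k : crosses_once w ->
  (fox (wval E w) k != 0%R) = (hyperplane k \in hyperplanes 1 w).
Proof.
move=> ow; apply/idP/idP => [|/mapP[e ew ke]].
  by apply: contraNT => /fox_notin ->.
by rewrite (fox_hyperplane _ ke) fox_crossing // /orientation; case: e.2.
Qed.

Lemma crosses_once_count u w : crosses_once u -> wval E u = wval E w ->
  count_mem x (supp u) <= count_mem x (supp w).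
Proof.
move=> ou uw; rewrite -(size_hyperplanes 1) -(size_hyperplanes 1 w).
apply: uniq_leq_size => // _ /mapP[e eu ->]; apply: contraT => /fox_notin.
by rewrite -uw fox_crossing // /orientation; case: e.2.
Qed.

Lemma lk_parab_predC1 g : g \in parab (adj E x) -> g \in parab (predC1 x).
Proof.
by apply: parabS => y; rewrite !inE /in_mem /=; apply: contraTneq => ->; rewrite adj_irr.
Qed.

Lemma crosses_once_predC1 w :
  crosses_once w -> wval E w \in parab (predC1 x) -> x \notin supp w.
Proof.
move=> ow /parab_word[u wu xu]; have := crosses_once_count ow wu.
have /count_memPn -> : x \notin supp u by rewrite -has_pred1 -all_predC.
by rewrite leqn0 => /eqP/count_memPn.
Qed.

Lemma lk_gen_commute g : g \in parab (adj E x) -> commute (gen E x) g.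
Proof.
move=> xg; apply: commute_sym; apply: (parab_gen_commute _ xg) => v xv.
exact/commute_sym/gen_commute.
Qed.

Lemma crosses_twice w : ~~ crosses_once w -> exists u b v c z,
  [/\ w = u ++ (x, b) :: v ++ (x, c) :: z,
      crosses_once ((x, b) :: v), crosses_once (rcons v (x, c))
    & hyperplane (crossing 1 (x, b)) =
      hyperplane (crossing (lval E (x, b) * wval E v) (x, c))].
Proof.
have [n] := ubnP (size w); elim: n w => // n IH [//|l w] wn Nw.
have [ow|/IH[]//] := boolP (crosses_once w); last first.
  by move=> u [b [v [c [z [-> ? ? ?]]]]]; exists (l :: u), b, v, c, z.
case/lastP: w => [|v l'] in wn Nw ow *.
  by case/negP: Nw; rewrite /crosses_once /hyperplanes /=; case: (l.1 == x).
have [ov|/IH[]] := boolP (crosses_once (l :: v)); first last.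
- move=> u [b [v' [c [z [e ? ? ?]]]]]; exists u, b, v', c, (rcons z l'); split=> //.
  by rewrite -rcons_cons e !rcons_cat /= rcons_cat.
- by move: wn; rewrite /= size_rcons.
have lx : l.1 == x.
  apply: contraNT Nw => lx; rewrite /crosses_once /hyperplanes /= (negbTE lx) /=.
  by rewrite -/(hyperplanes _ _) uniq_hyperplanes.
have l'x : l'.1 == x.
  apply: contraNT Nw => l'x; rewrite /crosses_once -rcons_cons -cats1 hyperplanes_cat.
  by rewrite [X in _ ++ X]/hyperplanes /= (negbTE l'x) /= cats0.
case: l l' => [y b] [y' c] /= in wn Nw lx l'x ov ow *.
move: lx l'x => /eqP yx /eqP y'x; rewrite {y}yx {y'}y'x in wn Nw ov ow *.
exists [::], b, v, c, [::]; split; rewrite /= ?cats1 //.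
apply/eqP; apply: contraNT Nw => ne.
move: ov ow; rewrite -[crosses_once (rcons _ _)](uniq_hyperplanes (lval E (x, b))).
rewrite /crosses_once -!cats1 /hyperplanes /= !crossings_cat /= eqxx /= mul1g.
move=> /andP[bv _].
by rewrite !map_cat /= => ->; rewrite andbT mem_cat negb_or bv /= inE.
Qed.

Definition pinch w := exists u b v z,
  [/\ w = u ++ (x, b) :: v ++ (x, ~~ b) :: z, x \notin supp v
    & wval E v \in parab (adj E x)].

Lemma pinch_infix u w v : pinch w -> pinch (u ++ w ++ v).
Proof.
move=> [u' [b [v' [z [-> xv Lv]]]]]; exists (u ++ u'), b, v', (z ++ v); split=> //.
by rewrite -!catA /= -catA.
Qed.

(* Britton's lemma. In a minimal subword that crosses a hyperplane twice, the Fox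
   derivative of the part between the two crossings has no cancellation, so this part
   lies in <lk x> only if it does not contain x. *)
Lemma Ncrosses_once_pinch w : ~~ crosses_once w -> pinch w.
Proof.
move=> /crosses_twice[u [b [v [c [z [-> ov ov' /hyperplaneP same]]]]]].
have once_lk s : crosses_once s -> wval E s \in parab (adj E x) -> x \notin supp s.
  by move=> os /lk_parab_predC1; apply: crosses_once_predC1.
have Nlk : wval E ((x, b) :: v) \notin parab (adj E x).
  by apply/negP => /(once_lk _ ov); rewrite inE eqxx.
have Nlk' : wval E (rcons v (x, c)) \notin parab (adj E x).
  by apply/negP => /(once_lk _ ov'); rewrite /supp /unzip1 map_rcons mem_rcons inE eqxx.
have [-> Lv] : c = ~~ b /\ wval E v \in parab (adj E x).
  move: same Nlk Nlk'; rewrite wval_cons wval_rcons /crossing /lval.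
  case: b c {ov ov'} => [] [] /=; rewrite ?mul1g ?invg1 ?mul1g ?invgK.
  - by rewrite -mulgA mulVKg => ->.
  - by rewrite mulVKg.
  - move=> Lv _ _; split=> //.
    suff -> : wval E v = gen E x * wval E v / gen E x by [].
    have /commute_sym/commute_conjg := lk_gen_commute Lv.
    by rewrite conjgE mulgVK mulKg.
  - by move=> ->.
exists u, b, v, z; split=> //; apply: once_lk Lv.
by have := @crosses_once_infix [::] v [:: (x, c)]; rewrite /= cats1; apply.
Qed.

End Integral.

(** * Cyclically reduced words *)

Lemma shortest_seq (T : Type) (P : seq T -> Prop) : (exists u, P u) ->
  exists2 u, P u & forall u', P u' -> size u <= size u'.
Proof.
move=> [u Pu]; pose Q n := `[< exists2 u, P u & size u = n >].
have exQ : exists n, Q n by exists (size u); apply/asboolP; exists u.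
case: (ex_minnP exQ) => n /asboolP[u0 Pu0 <-] min; exists u0 => // u' Pu'.
by apply: min; apply/asboolP; exists u'.
Qed.

Section WordPowers.
Variables (V : choiceType).
Implicit Types (u w : word V).

Definition wexp w n : word V := flatten (nseq n w).

Lemma wexpS w n : wexp w n.+1 = w ++ wexp w n. Proof. by []. Qed.

Lemma wexpSr w n : wexp w n.+1 = wexp w n ++ w.
Proof. by elim: n => [|n IH]; rewrite wexpS ?cats0 // -catA -IH. Qed.

Lemma wexpD w m n : wexp w (m + n) = wexp w m ++ wexp w n.
Proof. by rewrite /wexp nseqD flatten_cat. Qed.

Lemma wexp_rot u w n : wexp (u ++ w) n.+1 = u ++ wexp (w ++ u) n ++ w.
Proof.
elim: n => [|n IH]; first by rewrite /wexp /= cats0.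
by rewrite wexpSr IH (wexpSr _ n) !catA.
Qed.

Lemma wval_wexp (E : rel V) w n : wval E (wexp w n) = wval E w ^+ n.
Proof. by elim: n => [|n IH] //; rewrite wexpS wval_cat IH expgS. Qed.

Lemma count_supp_wexp x w n : count_mem x (supp (wexp w n)) = (n * count_mem x (supp w))%N.
Proof. by elim: n => // n IH; rewrite wexpS supp_cat count_cat IH mulSn. Qed.

End WordPowers.

Section CyclicallyReduced.
Variables (V : choiceType) (E : sgraph V).
Implicit Types (g h k t : raag E) (u w : word V) (x y : V).

Definition geodesic w := forall u, wval E u = wval E w -> size w <= size u.
Definition cyc_reduced w := forall u g, wval E u = wval E w ^ g -> size w <= size u.

Lemma geodesic_repr g : exists2 u, g = wval E u & geodesic u.
Proof.
have [|u <- min] := @shortest_seq _ (fun u => wval E u = g).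
  by exists (wrepr g); rewrite wreprK.
by exists u.
Qed.

Lemma cyc_reduced_repr g : exists w k, g = wval E w ^ k /\ cyc_reduced w.
Proof.
have [|u [k uk] min] := @shortest_seq _ (fun u => exists k, wval E u ^ k = g).
  by exists (wrepr g), 1; rewrite conjg1 wreprK.
exists u, k; split=> // u' h u'h; apply: min; exists (h^-1 * k).
by rewrite u'h conjgM conjgK.
Qed.

Lemma cyc_reduced_geodesic w : cyc_reduced w -> geodesic w.
Proof. by move=> cw u uw; apply: (cw u 1); rewrite conjg1. Qed.

Lemma size_wfilter_eq Y w : size w <= size (wfilter Y w) -> all Y (supp w).
Proof.
rewrite size_filter all_map all_count => le; rewrite eqn_leq count_size.
exact: le.
Qed.

Lemma geodesic_parab w (Y : pred V) :
  geodesic w -> wval E w \in parab Y -> all Y (supp w).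
Proof. by move=> gw /parabP; rewrite retr_wval => /gw/size_wfilter_eq. Qed.

Lemma cyc_reduced_rot u w : cyc_reduced (u ++ w) -> cyc_reduced (w ++ u).
Proof.
move=> cuw z g e; have := cuw z (wval E u * g).
rewrite !size_cat addnC; apply.
by rewrite e !wval_cat conjgM; congr (_ ^ g); rewrite conjgE !mulgA mulVg mul1g.
Qed.

Lemma geodesic_Npinch x w : geodesic w -> ~ pinch E x w.
Proof.
move=> gw [u [b [v [z [ew _ Lv]]]]].
have /gw : wval E (u ++ v ++ z) = wval E w.
  rewrite ew !wval_cat wval_cons wval_cat wval_cons lvalN; congr (_ * _).
  have xv : commute (lval E (x, b)) (wval E v).
    by apply/centrP/lval_closed/centrP/lk_gen_commute.
  by rewrite !mulgA xv mulgK.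
by rewrite ew !size_cat /= size_cat /= !addnS ltnNge leqnSn.
Qed.

Lemma geodesic_crosses_once x w : geodesic w -> crosses_once E x w.
Proof. by move=> gw; apply/negP=> /negP/Ncrosses_once_pinch/(geodesic_Npinch gw). Qed.

Lemma pinch_split x b a c : pinch E x (a ++ (x, b) :: c) ->
  pinch E x (rcons a (x, b)) \/ pinch E x ((x, b) :: c).
Proof.
have cat_prefix (v z : word V) e a' : x \notin supp v ->
    v ++ (x, e) :: z = a' ++ (x, b) :: c ->
    exists z', rcons a' (x, b) = v ++ (x, e) :: z'.
  elim: v a' => [|l v IH] [|l' a'] //=.
  - by move=> _ [-> _]; exists [::].
  - by move=> _ [-> _]; exists (rcons a' (x, b)).
  - by move=> + [le _]; rewrite inE le eqxx.
  - by rewrite inE negb_or => /andP[_ xv] [-> /(IH _ xv)[z' ->]]; exists z'.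
move=> [u [e [v [z [eq xv Lv]]]]]; elim: a u eq => [|l a IH] u eq.
  by right; exists u, e, v, z; split=> //; rewrite -eq.
case: u eq => [|l' u] [-> eq] /=.
  have [z' ->] := cat_prefix _ _ _ _ xv (esym eq).
  by left; exists [::], e, v, z'.
case: (IH u eq) => [p|]; last by right.
by left; have := pinch_infix [:: l'] [::] p; rewrite cats0.
Qed.

Lemma cyc_reduced_Npinch_rcons x b w :
  cyc_reduced ((x, b) :: w) -> ~ pinch E x (rcons ((x, b) :: w) (x, b)).
Proof.
move=> cw [u [e [v [z [eq xv Lv]]]]].
case/lastP: z eq => [|z l] eq; last first.
  apply: (geodesic_Npinch (x := x) (cyc_reduced_geodesic cw)).
  exists u, e, v, z; split=> //; move: eq.
  by rewrite -rcons_cons -rcons_cat -rcons_cons -rcons_cat => /rcons_inj[].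
case: u eq => [[<-]|l u [_ eq]].
  by rewrite -cats1 => /(congr1 (last (x, ~~ b))); rewrite !last_cat; case: (b).
apply: (geodesic_Npinch (x := x) (w := rcons w (x, b))); last by exists u, e, v, [::].
by apply/cyc_reduced_geodesic; rewrite -cats1; apply: cyc_reduced_rot.
Qed.

Lemma pinch_wexp x b w n : pinch E x (wexp ((x, b) :: w) n) ->
  pinch E x (rcons ((x, b) :: w) (x, b)).
Proof.
elim: n => [[[|? ?] [? [? [? []]]]] //|[|n] IH]; rewrite wexpS.
  rewrite cats0 => pw; have := @pinch_infix _ E x [::] _ [:: (x, b)] pw.
  by rewrite cats1.
by move=> /(@pinch_split _ _ (_ :: w) (w ++ wexp _ n))[//|]; apply: IH.
Qed.

Lemma cyc_reduced_wexp x w n : cyc_reduced w -> crosses_once E x (wexp w n).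
Proof.
wlog [b [w' ->]] : w n / exists b w', w = (x, b) :: w' => [wl cw|cw]; last first.
  apply/negP => /negP/Ncrosses_once_pinch/pinch_wexp.
  exact: cyc_reduced_Npinch_rcons.
have [/supp_letter[b lw]|xw] := boolP (x \in supp w); last first.
  rewrite /crosses_once /hyperplanes crossings_nil //.
  by apply/count_memPn; rewrite count_supp_wexp (count_memPn xw) muln0.
move/splitPr: lw cw => [a c] cw.
have : crosses_once E x (wexp ((x, b) :: c ++ a) n.+1).
  by apply: wl; [exists b, (c ++ a) | rewrite -cat_cons; apply: cyc_reduced_rot].
by rewrite -cat_cons wexp_rot; apply: crosses_once_infix.
Qed.

(* If (w^n)^k avoided x, then w^(nm) would cross only as many x-hyperplanes as k and its
   inverse, for every m, whereas it crosses at least m of them. *)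
Lemma cyc_reduced_conj_predC1 x w n k : cyc_reduced w -> x \in supp w -> 0 < n ->
  (wval E w ^+ n) ^ k \notin parab (predC1 x).
Proof.
move=> cw xw n0; apply/negP => /parab_word[c ec xc].
have c0 : count_mem x (supp c) = 0 by apply/count_memPn; rewrite -has_pred1 -all_predC.
have eq_w m : wval E (wexp w (n * m)) =
    wval E (wrepr k ++ wexp c m ++ winv (wrepr k)).
  rewrite !wval_cat wval_winv !wval_wexp wreprK expgnA -ec -conjXg conjgE.
  by rewrite -!mulgA mulVKg mulgV mulg1.
pose K := count_mem x (supp (wrepr k)).
have := crosses_once_count (cyc_reduced_wexp x _ cw) (eq_w (2 * K).+1).
rewrite !supp_cat !count_cat !count_supp_wexp c0 muln0 add0n count_supp_winv -/K.
rewrite addnn -mul2n leqNgt => /negP[]; rewrite -[X in X <= _]mul1n mulnAC leq_mul //.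
by rewrite muln_gt0 n0 -has_count has_pred1.
Qed.

Lemma cyc_reduced_conj_parab (Y : pred V) w n k : cyc_reduced w -> 0 < n ->
  (wval E w ^+ n) ^ k \in parab Y -> {subset supp w <= Y}.
Proof.
move=> cw n0 Yw x xw; apply: contraT => NYx.
have /negP[] := cyc_reduced_conj_predC1 k cw xw n0.
by apply: parabS Yw => y Yy; rewrite inE; apply: contraNneq NYx => <-.
Qed.

Lemma cyc_reduced_conj_supp w w' k : cyc_reduced w -> wval E w ^ k = wval E w' ->
  {subset supp w <= supp w'}.
Proof.
move=> cw ww'; apply: (@cyc_reduced_conj_parab (mem (supp w')) w 1 k) => //.
by rewrite expg1 ww' parab_supp.
Qed.

Lemma cyc_reducedX_neq1 w n : cyc_reduced w -> w != [::] -> 0 < n -> wval E w ^+ n != 1.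
Proof.
move=> cw /supp_neq_nil[x xw] n0; apply: contraNneq (cyc_reduced_conj_predC1 1 cw xw n0).
by move=> ->; rewrite conj1g gpred1.
Qed.

Definition link (s : seq V) : pred V := fun z => all (E z) s.
Definition star (s : seq V) : pred V := predU (mem s) (link s).

Lemma star1E x z : star [:: x] z = (z == x) || E x z.
Proof. by rewrite /star /link /= inE andbT adj_sym. Qed.

Lemma link_joined s : joined E (mem s) (link s).
Proof. by move=> y z ys /allP/(_ _ ys); rewrite adj_sym. Qed.

(* A hyperplane of t dual to a letter z outside the support of w is fixed by a power of
   w, so z commutes with the support of w. *)
Lemma cyc_reduced_letter_link w n a z b c h : cyc_reduced w -> 0 < n ->
  h \in parab (mem (supp w)) -> geodesic (a ++ (z, b) :: c) -> z \notin supp w ->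
  wval E w ^+ n * wval E (a ++ (z, b) :: c) = wval E (a ++ (z, b) :: c) * h ->
  link (supp w) z.
Proof.
move=> cw n0 wh gt zw eq.
have sub : {subset parab (E := E) (mem (supp w)) <= parab (predC1 z)}.
  by apply: parabS => y yw; rewrite inE; apply: contraNneq zw => <-.
pose e := (crossing z (1 * wval E a) (z, b), b).
have te : fox z (wval E (a ++ (z, b) :: c)) e.1 != 0%R.
  rewrite fox_neq0 ?geodesic_crosses_once //; apply: map_f.
  by rewrite crossings_cat /= eqxx mem_cat inE eqxx orbT.
have [||m m0] := fox_stabilizer _ _ eq te; [|exact: sub|].
  by apply/sub/gpredXn/parab_supp.
rewrite -expgnA => /cyc_reduced_conj_parab wz; apply/allP => y yw.
by apply: wz => //; rewrite muln_gt0 n0.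
Qed.

Lemma cyc_reduced_conj_star w n t h : cyc_reduced w -> 0 < n ->
  h \in parab (mem (supp w)) -> wval E w ^+ n * t = t * h -> t \in parab (star (supp w)).
Proof.
move=> cw n0 wh; have [u -> gu] := geodesic_repr t; have [m] := ubnP (size u).
elim: m u gu => // m IH u gu um eq.
have [us|] := boolP (all (mem (supp w)) (supp u)).
  by apply: wval_parab; apply: sub_all us => y yw; apply/orP; left.
rewrite -has_predC has_map => uw; move: gu um eq.
case/split_find: uw => -[z b] a c /= zw; rewrite -all_predC cat_rcons => aw.
move=> gu um eq; have wz := cyc_reduced_letter_link cw n0 wh gu zw eq.
have wa : wval E a \in parab (mem (supp w)).
  by apply: wval_parab; rewrite all_map; apply: sub_all aw => l; apply: contraNT.
have zC g : g \in parab (mem (supp w)) -> commute g (lval E (z, b)).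
  by move=> wg; apply: parab_commute (@link_joined _) wg _; apply/lval_closed/gen_parab.
have uE : wval E (a ++ (z, b) :: c) = lval E (z, b) * wval E (a ++ c).
  by rewrite !wval_cat wval_cons !mulgA (zC _ wa).
have [u' u'E gu'] := geodesic_repr (wval E (a ++ c)).
rewrite uE u'E; apply: gpredM.
  by apply/lval_closed/gen_parab/orP; right.
apply: IH => //.
  apply: leq_ltn_trans (gu' (a ++ c) u'E) _.
  by rewrite -ltnS; apply: leq_trans um; rewrite !size_cat /= addnS.
apply: (mulgI (lval E (z, b))); rewrite -u'E mulgA -(zC (wval E w ^+ n)).
  by rewrite -mulgA -uE eq uE mulgA.
exact/gpredXn/parab_supp.
Qed.

Lemma cyc_reduced_commute_star w n g : cyc_reduced w -> 0 < n ->
  commute (wval E w ^+ n) g -> g \in parab (star (supp w)).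
Proof.
move=> cw n0; apply: cyc_reduced_conj_star cw n0 _.
exact/gpredXn/parab_supp.
Qed.

Lemma cyc_reduced_gen x : cyc_reduced [:: (x, false)].
Proof.
move=> [|//] g /= /esym/eqP; rewrite wval0 conjg_eq1 => /eqP gen1.
by have := genX_neq1 E x (ltn0Sn 0); rewrite expg1 /gen gen1 eqxx.
Qed.

Lemma genX_commute_star x n g :
  0 < n -> commute (gen E x ^+ n) g -> g \in parab (star [:: x]).
Proof. exact/cyc_reduced_commute_star/cyc_reduced_gen. Qed.

Lemma star_commute x g : g \in parab (star [:: x]) -> commute (gen E x) g.
Proof.
move=> xg; apply: commute_sym; apply: parab_gen_commute xg => z.
by rewrite star1E => /predU1P[->//|/gen_commute/commute_sym].
Qed.

Lemma genX_commute x n g : 0 < n -> commute (gen E x ^+ n) g <-> commute (gen E x) g.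
Proof.
by move=> n0; split=> [/(genX_commute_star n0)/star_commute|/commute_sym xg];
  last exact/commute_sym/commuteX.
Qed.

Lemma gen_commute_adj x y : commute (gen E x) (gen E y) -> x != y -> E x y.
Proof.
move=> /(@genX_commute_star x 1 _ isT).
move=> /(geodesic_parab (cyc_reduced_geodesic (@cyc_reduced_gen y))) /=.
by rewrite andbT star1E eq_sym => /predU1P[->|//]; rewrite eqxx.
Qed.

Lemma genX_inj_vertex x y m n : 0 < m -> gen E x ^+ m = gen E y ^+ n -> x = y.
Proof.
move=> m0 e; apply/eqP.
apply: (@cyc_reduced_conj_parab (pred1 y) [:: (x, false)] m 1) => //=.
- exact: cyc_reduced_gen.
- by rewrite conjg1 -/(gen E x) e gpredXn ?gen_parab /=.
- exact: mem_head.
Qed.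

Lemma gen_conj_inj x y g h : gen E x ^ g = gen E y ^ h -> x = y.
Proof.
move=> e; have : gen E x ^ (g / h) = gen E y by rewrite conjgM e conjgK.
move=> /(cyc_reduced_conj_supp (@cyc_reduced_gen x))/(_ x).
by rewrite /= !inE eqxx => /(_ isT)/eqP.
Qed.

Lemma conj_genX_commute x n g h :
  0 < n -> commute ((gen E x ^ g) ^+ n) h <-> commute (gen E x ^ g) h.
Proof. by move=> n0; rewrite -conjXg !commuteJl genX_commute. Qed.

Lemma conj_genX_commute2 x y m n g h : 0 < m -> 0 < n ->
  commute ((gen E x ^ g) ^+ m) ((gen E y ^ h) ^+ n) <-> commute (gen E x ^ g) (gen E y ^ h).
Proof.
move=> m0 n0; rewrite conj_genX_commute //.
by split=> /commute_sym/(conj_genX_commute _ _ _ n0)/commute_sym.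
Qed.

Lemma conj_genX_inj x n g h : 0 < n ->
  (gen E x ^ g) ^+ n = (gen E x ^ h) ^+ n -> gen E x ^ g = gen E x ^ h.
Proof.
rewrite -!conjXg => n0 e.
have : commute (gen E x ^+ n) (g / h).
  by apply/commgP/conjg_fixP; rewrite conjgM e conjgK.
move=> /(genX_commute _ _ n0)/commute_conjg {2}<-.
by rewrite -conjgM mulgVK.
Qed.

Lemma raag_torsion_free g n : 0 < n -> g ^+ n = 1 -> g = 1.
Proof.
move=> n0; have [w [k [-> cw]]] := cyc_reduced_repr g; rewrite -conjXg => /eqP.
rewrite conjg_eq1; have [->|w0] := eqVneq w [::]; first by rewrite wval0 conj1g.
by rewrite (negbTE (cyc_reducedX_neq1 cw w0 n0)).
Qed.

End CyclicallyReduced.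

(** * Irreducible elements and parabolic closures *)

Section Irreducible.
Variables (V : choiceType) (E : sgraph V).
Implicit Types (g h k t : raag E) (u w : word V) (x y : V) (s : seq V) (Y : pred V).

(* The complement graph of E is connected on s. *)
Definition coconnected s := forall Y, has Y s -> has (predC Y) s ->
  exists y z, [/\ y \in s, z \in s, Y y, ~~ Y z & ~~ E y z].

Lemma eq_coconnected s s' : s =i s' -> coconnected s -> coconnected s'.
Proof.
move=> ss' cs Y; rewrite -!(eq_has_r ss') => hY hNY.
by have [y [z [ys zs Yy NYz yz]]] := cs Y hY hNY; exists y, z; rewrite -!ss'.
Qed.

Lemma coconnected_join s Y Z : coconnected s -> joined E Y Z ->
  all (predU Y Z) s -> all Y s \/ all Z s.
Proof.
move=> cs YZ /allP YZs; have [Ys|] := boolP (all Y s); first by left.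
rewrite -has_predC => hNY; right; have [hY|] := boolP (has Y s).
  have [y [z [_ zs Yy NYz /negP[]]]] := cs Y hY hNY.
  by apply: YZ => //; have := YZs z zs; rewrite /= (negbTE NYz).
rewrite -all_predC => /allP NY; apply/allP => z zs.
by have := YZs z zs; rewrite /= (negbTE (NY z zs)).
Qed.

Lemma coconnected1 s x : x \in s -> coconnected s ->
  (forall y, y \in s -> y != x -> E x y) -> forall y, y \in s -> y = x.
Proof.
move=> xs cs sx y ys; apply/eqP; apply: contraT => yx.
have [||y' [z [_ zs /eqP -> zx]]] := cs (pred1 x).
- by apply/hasP; exists x; rewrite /=.
- by apply/hasP; exists y.
by rewrite sx.
Qed.

Lemma joined_sym Y Z : joined E Y Z -> joined E Z Y.
Proof. by move=> YZ z y Zz Yy; rewrite adj_sym YZ. Qed.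

Lemma joined_disjoint Y Z y : joined E Y Z -> Y y -> ~~ Z y.
Proof. by move=> YZ Yy; apply/negP => /(YZ _ _ Yy); rewrite adj_irr. Qed.

Lemma parab_join_split Y Z g : joined E Y Z -> g \in parab (predU Y Z) ->
  g = retr Y g * retr Z g.
Proof.
move=> YZ /parab_word[w -> YZw]; rewrite !retr_wval.
elim: w YZw => [|l w IH] /=; first by rewrite mul1g.
move=> /andP[YZl /IH {IH} e]; have [Yl|NYl] := boolP (Y l.1).
  by rewrite (negbTE (joined_disjoint YZ Yl)) !wval_cons -mulgA -e.
rewrite (negbTE NYl) /= in YZl; rewrite YZl !wval_cons e !mulgA; congr (_ * _).
apply: (parab_commute (joined_sym YZ)); first exact/lval_closed/gen_parab.
by apply: wval_parab; rewrite supp_wfilter filter_all.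
Qed.

Lemma parab_join_conj Y Z g h : joined E Y Z -> g \in parab (predU Y Z) ->
  h \in parab Y -> h ^ g \in parab Y.
Proof.
move=> YZ /(parab_join_split YZ) -> Yh.
have Yhg : h ^ retr Y g \in parab Y by rewrite gpredJ ?retr_parab.
by rewrite conjgM (commute_conjg (parab_commute YZ Yhg (retr_parab _ _))).
Qed.

Lemma parab_star_conj s g h : g \in parab (star E s) ->
  h \in parab (mem s) -> h ^ g \in parab (mem s).
Proof. exact/parab_join_conj/link_joined. Qed.

Lemma parab_star_link_conj s g h : g \in parab (star E s) ->
  h \in parab (link E s) -> h ^ g \in parab (link E s).
Proof.
move=> sg; apply: (parab_join_conj (joined_sym (@link_joined _ E s))).
by apply: parabS sg => y; rewrite !inE orbC.
Qed.

Lemma parab_conj_cyc_reduced Y g : g \in parab Y -> exists w k,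
  [/\ g = wval E w ^ k, cyc_reduced E w, all Y (supp w) & k \in parab Y].
Proof.
move=> /parabP Yg; have [w [k [gw cw]]] := cyc_reduced_repr g.
have ew : wval E w ^ k = wval E (wfilter Y w) ^ retr Y k.
  by rewrite -gw -{1}Yg gw gmulfJ /= retr_wval.
have Yw : all Y (supp w).
  apply: size_wfilter_eq; apply: (cw _ (k / retr Y k)).
  by rewrite conjgM ew conjgK.
by exists w, (retr Y k); rewrite retr_parab gw ew all_supp.
Qed.

(* Hence <supp w>^t is the smallest parabolic subgroup that contains w^t. *)
Lemma cyc_reduced_conj_parab_supp w t h Y : cyc_reduced E w ->
  wval E w ^ t \in parab Y -> h \in parab (mem (supp w)) -> h ^ t \in parab Y.
Proof.
move=> cw Yw wh; have [u [p [e cu /allP Yu Yp]]] := parab_conj_cyc_reduced Yw.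
have ewu : wval E w ^ (t / p) = wval E u by rewrite conjgM e conjgK.
have uw : {subset supp u <= supp w}.
  by apply: (cyc_reduced_conj_supp (k := (t / p)^-1) cu); rewrite -ewu conjgK.
have wu := cyc_reduced_conj_supp cw ewu.
have tp : t / p \in parab (star E (supp w)).
  apply: (@cyc_reduced_conj_star _ _ w 1 _ (wval E u)) => //.
    exact: parabS (parab_supp _ u).
  by rewrite expg1 -ewu conjgC.
rewrite -[t](mulgVK p) conjgM; apply: gpredJ => //.
by apply: parabS (parab_star_conj tp wh) => y /wu/Yu.
Qed.

Definition core g : word V := sval (cid (cyc_reduced_repr g)).
Definition conjugator g : raag E := sval (cid (svalP (cid (cyc_reduced_repr g)))).

Lemma coreE g : wval E (core g) ^ conjugator g = g.
Proof. by rewrite /core /conjugator; case: cid => w ex /=; case: cid => k /= []. Qed.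

Lemma core_cyc_reduced g : cyc_reduced E (core g).
Proof. by rewrite /core; case: cid => w /= [k []]. Qed.

Lemma mem_supp_core w k : cyc_reduced E w -> supp (core (wval E w ^ k)) =i supp w.
Proof.
move=> cw x; have e := coreE (wval E w ^ k).
have e' : wval E (core (wval E w ^ k)) ^ (conjugator (wval E w ^ k) / k) = wval E w.
  by rewrite conjgM e conjgK.
have e'' := canRL (conjgK _) e'.
apply/idP/idP => [|/(cyc_reduced_conj_supp cw (esym e'')) //].
exact: cyc_reduced_conj_supp (@core_cyc_reduced _) e' x.
Qed.

Definition pclosure g : {pred raag E} :=
  conjg_pred (parab (mem (supp (core g)))) (conjugator g).
HB.instance Definition _ g :=
  GroupClosed.copy (pclosure g) (conjg_pred (parab (mem (supp (core g)))) (conjugator g)).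

Lemma mem_pclosure g : g \in pclosure g.
Proof. by rewrite -{1}(coreE g) conjg_predJ parab_supp. Qed.

Lemma pclosure_min g k Y :
  g \in conjg_pred (parab Y) k -> {subset pclosure g <= conjg_pred (parab Y) k}.
Proof.
move=> Yg h; rewrite !inE => gh; rewrite -(conjgKV (conjugator g) h) -conjgM.
apply: cyc_reduced_conj_parab_supp (@core_cyc_reduced g) _ gh.
by rewrite conjgM coreE.
Qed.

Lemma pclosureE w k : cyc_reduced E w ->
  pclosure (wval E w ^ k) =i conjg_pred (parab (mem (supp w))) k.
Proof.
move=> cw h; apply/idP/idP; first by apply: pclosure_min; rewrite conjg_predJ parab_supp.
move=> wh; rewrite inE -(conjgKV k h) -conjgM.
apply: (cyc_reduced_conj_parab_supp cw _ wh); rewrite conjgM.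
exact: mem_pclosure.
Qed.

Definition irreducible g := g != 1 /\ coconnected (supp (core g)).

Lemma irreducible_conj w k : cyc_reduced E w ->
  irreducible (wval E w ^ k) <-> w != [::] /\ coconnected (supp w).
Proof.
move=> cw; rewrite /irreducible conjg_eq1.
have eqs := mem_supp_core k cw; split=> -[w1 cs]; split.
- by apply: contraNneq w1 => ->.
- exact: eq_coconnected cs.
- by have := cyc_reducedX_neq1 cw w1 (ltn0Sn 0); rewrite expg1.
- exact: eq_coconnected (fsym eqs) cs.
Qed.

Lemma irreducibleJ g k : irreducible (g ^ k) <-> irreducible g.
Proof.
by rewrite -(coreE g) -conjgM !irreducible_conj //; apply: core_cyc_reduced.
Qed.

Lemma irreducible_core_neq_nil g : irreducible g -> exists x, x \in supp (core g).
Proof.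
rewrite -{1}(coreE g) => /(irreducible_conj _ (@core_cyc_reduced g))[].
by move=> /supp_neq_nil.
Qed.

Lemma irreducible_star s g : irreducible g -> g \in parab (star E s) ->
  g \in parab (mem s) \/ g \in parab (link E s).
Proof.
move=> ig /parab_conj_cyc_reduced[w [k [e cw sw sk]]].
move: ig; rewrite {}e => /(irreducible_conj _ cw)[_ iw].
have [ws|wl] := coconnected_join iw (@link_joined _ E s) sw.
  by left; apply: parab_star_conj => //; apply: wval_parab.
by right; apply: parab_star_link_conj => //; apply: wval_parab.
Qed.

Lemma irreducible_commute_cyc_reduced w g :
  cyc_reduced E w -> irreducible g -> commute (wval E w) g ->
  g \in parab (mem (supp w)) \/ g \in parab (link E (supp w)).
Proof.
move=> cw ig wg; apply: irreducible_star ig _.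
exact: (@cyc_reduced_commute_star _ _ w 1).
Qed.

End Irreducible.

(** * Centralizers of irreducible elements *)

Lemma near_notin (T : eqType) (f : nat -> T) (s : seq T) :
  injective f -> \forall n \near \oo, f n \notin s.
Proof.
move=> finj; elim: s => [|a s IH]; first by apply: nearW.
have [[m fm]|Nm] := pselect (exists m, f m = a).
  near=> n; rewrite inE negb_or -fm (inj_eq finj) gtn_eqF; last first.
    by near: n; exists m.+1.
  by near: n.
near=> n; rewrite inE negb_or; apply/andP; split; last by near: n.
by apply/eqP => fn; apply: Nm; exists n.
Unshelve. all: by end_near. Qed.

Lemma eventually_constant (T : Type) (f : nat -> T) :
  (\forall n \near \oo, f n.+1 = f n) -> exists a, \forall n \near \oo, f n = a.
Proof.
move=> [N _ fN]; exists (f N), N => // n /= /subnKC <-.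
elim: (n - N) => [|m IH]; first by rewrite addn0.
by rewrite addnS fN //= leq_addr.
Qed.

Section Axis.
Variables (V : choiceType) (E : sgraph V) (w : word V) (x : V).
Hypotheses (cw : cyc_reduced E w) (iw : coconnected E (supp w)) (xw : x \in supp w).
Implicit Types (g h k : raag E).
Local Notation r := (wval E w).

Lemma hyperplane_exp_inj k : injective (fun n => hyperplane x (r ^+ n * k)).
Proof.
move=> m n; wlog mn : m n / m <= n.
  by move=> H; case: (leqP m n) => [|/ltnW] le e; [apply: H | apply/esym/H].
move=> /hyperplaneP; rewrite -(subnKC mn); case: (n - m) => [|d]; first by rewrite addn0.
rewrite expgnDr invgM -!mulgA mulKg mulgA => /lk_parab_predC1.
by rewrite -[X in X \in _]mulgA (negbTE (cyc_reduced_conj_predC1 k cw xw (ltn0Sn d))).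
Qed.

Lemma hyperplane_expV_inj k : injective (fun n => hyperplane x (r ^- n * k)).
Proof.
have shiftE a b : r ^- (a + b) * (r ^+ b * k) = r ^- a * k.
  by rewrite addnC expgnDr invgM -mulgA mulKg.
move=> m n /eqP; rewrite -(shiftE m n) -(shiftE n m) addnC hyperplaneMl => /eqP.
by move/hyperplane_exp_inj.
Qed.

Lemma near_fox0 g k : \forall n \near \oo,
  fox x g (r ^+ n * k) = 0%R /\ fox x g (r ^- n * k) = 0%R.
Proof.
rewrite -(wreprK g); near=> n; split; apply: fox_notin; near: n.
  exact: near_notin (@hyperplane_exp_inj k).
exact: near_notin (@hyperplane_expV_inj k).
Unshelve. all: by end_near. Qed.

(* The signed x-hyperplanes crossed by the segment from r^-n to r^n of the axis of r,
   translated by r^n in order to start at 1. *)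
Definition segment n k : int := fox x (r ^+ (n + n)) (r ^+ n * k).

Lemma segment_end n k : r ^- (n + n) * (r ^+ n * k) = r ^- n * k.
Proof. by rewrite expgnDr invgM -mulgA mulKg. Qed.

Lemma segment_constant k : exists a, \forall n \near \oo, segment n k = a.
Proof.
apply: eventually_constant; near=> n; rewrite /segment.
have -> : r ^+ (n.+1 + n.+1) = r * (r ^+ (n + n) * r).
  by rewrite addnS addSn expgS expgSr.
rewrite !foxM [r^-1 * _]mulgA {2 3}expgS mulKg segment_end.
have [_ ->] : fox x r (r ^+ n * k) = 0%R /\ fox x r (r ^- n * k) = 0%R.
  by near: n; apply: near_fox0.
have [-> _] : fox x r (r ^+ n.+1 * k) = 0%R /\ fox x r (r ^- n.+1 * k) = 0%R.
  by near: n; have [N _ H] := near_fox0 r k; exists N => // n /= /leqW; apply: H.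
by rewrite add0r addr0.
Unshelve. all: by end_near. Qed.

(* The signed x-hyperplanes crossed by the whole axis of r. *)
Definition axis k : int := sval (cid (segment_constant k)).

Lemma axisP k : \forall n \near \oo, segment n k = axis k.
Proof. exact: svalP (cid (segment_constant k)). Qed.

Lemma axis_lk_invariant : lk_invariant x axis.
Proof.
move=> k l xl; near \oo => n.
have <- : segment n k = axis k by near: n; apply: axisP.
have <- : segment n (k * l) = axis (k * l) by near: n; apply: axisP.
by rewrite /segment mulgA; apply: fox_hyperplane; rewrite hyperplaneMr.
Unshelve. all: by end_near. Qed.

Lemma axis_centralizer g k : commute r g -> axis (g * k) = axis k.
Proof.
move=> rg; near \oo => n.
have <- : segment n k = axis k by near: n; apply: axisP.
have <- : segment n (g * k) = axis (g * k) by near: n; apply: axisP.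
have [fg fg'] : fox x g (r ^+ n * (g * k)) = 0%R /\ fox x g (r ^- n * (g * k)) = 0%R.
  by near: n; apply: near_fox0.
have gr m : commute g (r ^+ m) by apply/commuteX/commute_sym.
have := foxM x g (r ^+ (n + n)) (r ^+ n * (g * k)).
rewrite (gr (n + n)) foxM fg add0r segment_end fg' addr0 /segment => ->.
by rewrite [r ^+ n * _]mulgA -(gr n) -!mulgA mulKg.
Unshelve. all: by end_near. Qed.

Lemma axis_crossing e : e \in crossings x (1 : raag E) w -> axis e.1 = orientation e.2.
Proof.
move=> ew; have [N _ axisN] := axisP e.1.
rewrite -(axisN N.+1 (leqnSn N)) /segment -wval_wexp.
apply: (@fox_crossing _ _ _ _ (r ^+ N.+1 * e.1, e.2)); first exact: cyc_reduced_wexp.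
rewrite wexpD crossings_cat mem_cat wval_wexp mul1g; apply/orP; right.
rewrite wexpS crossings_cat mem_cat; apply/orP; left.
rewrite -[X in crossings x X w]mulg1 crossingsM.
exact: (map_f (fun e => (r ^+ N.+1 * e.1, e.2)) ew).
Qed.

Lemma axis_neq0 k : axis k != 0%R -> exists n m e, e \in crossings x (1 : raag E) w /\
  hyperplane x (r ^+ n * k) = hyperplane x (r ^+ m * e.1).
Proof.
have [n _ axisn] := axisP k; rewrite -(axisn n (leqnn n)) /segment -wval_wexp => Ak.
have {Ak} : hyperplane x (r ^+ n * k) \in hyperplanes x 1 (wexp w (n + n)).
  by apply: contraNT Ak => /fox_notin ->.
exists n; elim: (n + n)%N H => // m IH.
rewrite wexpSr hyperplanes_cat mem_cat => /orP[/IH //|].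
rewrite wval_wexp mul1g -[r ^+ m]mulg1 /hyperplanes crossingsM -map_comp.
by move=> /mapP[e ew ->]; exists m, e.
Qed.

(* The signed translation length along the axis of r. *)
Definition translation g : int := integral x axis 1 (wrepr g).

Lemma translation_wval u : translation (wval E u) = integral x axis 1 u.
Proof. exact/integral_raag_eq/raag_eq_wrepr/axis_lk_invariant. Qed.

Lemma translationM g h :
  commute r g -> translation (g * h) = (translation g + translation h)%R.
Proof.
move=> rg; rewrite -(wreprK h) -{1}(wreprK g) -wval_cat !translation_wval.
rewrite integral_cat wreprK; congr (_ + _)%R; rewrite mul1g -[g]mulg1 integralM.
by apply: eq_bigr => e _; rewrite axis_centralizer.
Qed.

Lemma translation1 : translation 1 = 0%R.
Proof. by rewrite -wval0 translation_wval integral_nil. Qed.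

Lemma translationX g n : commute r g -> translation (g ^+ n) = (translation g *+ n)%R.
Proof.
move=> rg; elim: n => [|n IH]; first exact: translation1.
by rewrite expgS translationM // IH mulrS.
Qed.

Lemma translationV g : commute r g -> translation g^-1 = (- translation g)%R.
Proof.
by move=> rg; apply/eqP; rewrite -addr_eq0 addrC -translationM // mulgV translation1.
Qed.

Lemma translation_gt0 : (0 < translation r)%R.
Proof.
rewrite translation_wval /integral big_seq (eq_bigr (fun=> 1%R)); last first.
  by move=> e ew; rewrite axis_crossing //; case: e.2.
rewrite -big_seq big_const_seq count_predT iter_addr_0 ltr0n size_crossings.
by rewrite -has_count has_pred1.
Qed.

Lemma centralizer_predC1 g k : g \in parab (mem (supp w)) -> commute r g ->
  g ^ k \in parab (predC1 x) -> g = 1.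
Proof.
move=> wg rg xg; have [u [p [eg cu /allP uw sp]]] := parab_conj_cyc_reduced wg.
have ur : commute (wval E u) (r ^ p^-1).
  by rewrite -commuteJl -eg; apply: commute_sym.
have ir : irreducible (r ^ p^-1).
  apply/(irreducible_conj _ cw); split=> //.
  by apply: contraTneq xw => ->.
have sub Y : r ^ p^-1 \in parab Y -> {subset supp w <= Y}.
  exact: (@cyc_reduced_conj_parab _ _ Y w 1 p^-1 cw isT).
have [/sub wu|/sub wl] := irreducible_commute_cyc_reduced cu ir ur.
  have := cyc_reduced_conj_predC1 (p * k) cu (wu x xw) (ltn0Sn 0).
  by rewrite expg1 conjgM -eg xg.
have [u0|/supp_neq_nil[y yu]] := eqVneq u [::]; first by rewrite eg u0 wval0 conj1g.
have := joined_disjoint (@link_joined _ E (supp u)) yu.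
by case/negP; apply/wl/uw.
Qed.

(* By the pigeonhole principle, two of the x-hyperplanes k^j e lie in the same orbit of
   the powers of r. *)
Lemma centralizer_commensurable k : k \in parab (mem (supp w)) -> commute r k ->
  exists i j m n, m < n /\ r ^+ i * k ^+ m = r ^+ j * k ^+ n.
Proof.
move=> wk rk; have [e0 e0w] := crossings_neq_nil (1 : raag E) xw.
have rkX j : commute r (k ^+ j) by apply: commuteX.
have axis_k j : axis (k ^+ j * e0.1) != 0%R.
  by rewrite axis_centralizer // axis_crossing //; case: e0.2.
have hit j : exists p : nat * nat * (raag E * bool), p.2 \in crossings x (1 : raag E) w /\
    hyperplane x (r ^+ p.1.1 * (k ^+ j * e0.1)) = hyperplane x (r ^+ p.1.2 * p.2.1).
  by have [n [m [e ne]]] := axis_neq0 (axis_k j); exists (n, m, e).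
have [f fP] := choice hit.
have [j|m [n [mn ef]]] := @pigeonhole_seq _ (fun j => (f j).2) (crossings x (1 : raag E) w).
  by have [] := fP j.
exists ((f n).1.2 + (f m).1.1)%N, ((f m).1.2 + (f n).1.1)%N, m, n; split=> //.
set g := _ * k ^+ m; set h := _ * k ^+ n.
have same : hyperplane x (g * e0.1) = hyperplane x (h * e0.1).
  have [_ /eqP c1] := fP m; have [_ /eqP c2] := fP n.
  move: c1 c2; rewrite -(hyperplaneMl x (r ^+ (f n).1.2)) => /eqP c1.
  rewrite -(hyperplaneMl x (r ^+ (f m).1.2)) => /eqP c2.
  move: c1 c2; rewrite !mulgA -!expgnDr -/g -/h => -> ->.
  by rewrite addnC ef.
have rg : commute r g by apply: commuteM => //; apply: commuteX.
have rh : commute r h by apply: commuteM => //; apply: commuteX.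
suff gh : g^-1 * h = 1 by apply/esym/(mulgI g^-1); rewrite gh mulVg.
apply: (@centralizer_predC1 _ e0.1).
- by rewrite gpredM ?gpredV ?gpredM ?gpredXn ?parab_supp.
- by apply: commuteM => //; apply: commuteV.
- by move/hyperplaneP: same; rewrite invgM -mulgA (mulgA g^-1) => /lk_parab_predC1.
Qed.

Lemma translation_eq0 k : k \in parab (mem (supp w)) -> commute r k ->
  translation k = 0%R -> k = 1.
Proof.
move=> wk rk k0; have [i [j [m [n [mn e]]]]] := centralizer_commensurable wk rk.
have ij : i = j.
  have := congr1 translation e; rewrite !translationM ?translationX //; try exact: commuteX.
  by rewrite k0 !mul0rn !addr0; apply/mulrIn/lt0r_neq0/translation_gt0.
apply: (@raag_torsion_free _ E _ (n - m)); first by rewrite subn_gt0.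
by rewrite expgnFr 1?ltnW //; move: e; rewrite ij => /mulgI ->; rewrite mulgV.
Qed.

Lemma centralizer_abelian g h :
  g \in parab (mem (supp w)) -> h \in parab (mem (supp w)) ->
  commute r g -> commute r h -> commute g h.
Proof.
move=> wg wh rg rh; apply/commgP/eqP; apply: translation_eq0.
- by rewrite gpredR.
- by rewrite commgEl conjgE; do ?apply: commuteM => //; apply: commuteV.
- rewrite commgEl conjgE !translationM ?translationV //; try exact: commuteV.
  by rewrite addrA addrACA !addNr.
Qed.

End Axis.

Lemma irreducible_centralizer_abelian (V : choiceType) (E : sgraph V) (g h c : raag E) :
  irreducible c -> g \in pclosure c -> h \in pclosure c ->
  commute c g -> commute c h -> commute g h.
Proof.
move=> ic; have [x xc] := irreducible_core_neq_nil ic; case: (ic) => _ cc.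
rewrite !inE => gc hc; rewrite -{1 2}(coreE c) !commuteJl => cg ch.
apply/(commuteJ g h (conjugator c)^-1).
exact: centralizer_abelian (@core_cyc_reduced _ _ c) cc xc _ _ gc hc cg ch.
Qed.

(** * Replacing irreducible elements by conjugates of vertices *)

Section Closures.
Variables (V : choiceType) (E : sgraph V).
Implicit Types (b c d g h k f : raag E) (x y z : V) (S : seq V).

Definition orthogonal b c :=
  forall g h, g \in pclosure b -> h \in pclosure c -> commute g h.

Lemma orthogonal_sym b c : orthogonal b c -> orthogonal c b.
Proof. by move=> bc g h cg bh; apply/commute_sym/bc. Qed.

Lemma orthogonal_commute b c : orthogonal b c -> commute b c.
Proof. by apply; apply: mem_pclosure. Qed.

Lemma eq_orthogonal b b' c c' : pclosure b =i pclosure b' -> pclosure c =i pclosure c' ->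
  orthogonal b c -> orthogonal b' c'.
Proof. by move=> bb' cc' bc g h; rewrite -bb' -cc'; apply: bc. Qed.

Lemma Northogonal_witness b c : ~ orthogonal b c ->
  exists2 g, g \in pclosure b & exists2 h, h \in pclosure c & ~ commute g h.
Proof.
move=> /existsNP[g /existsNP[h /not_implyP[bg /not_implyP[ch gh]]]].
by exists g => //; exists h.
Qed.

Lemma irreducible_commute_closures b c : irreducible b -> irreducible c -> commute b c ->
  orthogonal b c \/ pclosure b =i pclosure c.
Proof.
have half b' c' : irreducible b' -> irreducible c' -> commute b' c' ->
    orthogonal b' c' \/ {subset pclosure c' <= pclosure b'}.
  move=> ib ic; rewrite -{1}(coreE b') commuteJl => bc.
  have := irreducible_commute_cyc_reduced (@core_cyc_reduced _ _ b') _ bc.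
  case=> [|cb|cl]; [exact/irreducibleJ | by right; apply: pclosure_min | left].
  move=> g h bg /(pclosure_min (k := conjugator b') cl) lh.
  apply/(commuteJ _ _ (conjugator b')^-1).
  exact: parab_commute (@link_joined _ _ _) bg lh.
move=> ib ic bc; have [|cb] := half _ _ ib ic bc; first by left.
have [/orthogonal_sym|bc'] := half _ _ ic ib (commute_sym bc); first by left.
by right=> h; apply/idP/idP; [apply: bc' | apply: cb].
Qed.

(* Commuting irreducible elements with the same parabolic closure translate along the
   same axis. *)
Definition coaxial b c := pclosure b =i pclosure c /\ commute b c.

Lemma coaxial_refl b : coaxial b b. Proof. by []. Qed.

Lemma coaxial_sym b c : coaxial b c -> coaxial c b.
Proof. by move=> [bc com]; split=> [h|]; [rewrite bc | apply: commute_sym]. Qed.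

Lemma coaxial_trans b c d : irreducible c -> coaxial b c -> coaxial c d -> coaxial b d.
Proof.
move=> ic [bc com_bc] [cd com_cd]; split=> [h|]; first by rewrite bc cd.
apply: irreducible_centralizer_abelian ic _ _ (commute_sym com_bc) com_cd.
  by rewrite -bc mem_pclosure.
by rewrite cd mem_pclosure.
Qed.

(* [vertex_in b v k]: the conjugate of v by k is one of the generators of a system of
   generating vertices of the parabolic closure of b. *)
Definition vertex_in b v k :=
  v \in supp (core b) /\ k / conjugator b \in parab (mem (supp (core b))).

Lemma vertex_in_pclosure b v k : vertex_in b v k -> gen E v ^ k \in pclosure b.
Proof. by move=> [bv bk]; rewrite inE -conjgM gpredJ ?gen_parab. Qed.

Lemma pclosure_central_vertex (S : groupClosed (raag E)) b v k :
  irreducible b -> vertex_in b v k ->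
  (forall g, g \in pclosure b -> commute (gen E v ^ k) g) ->
  gen E v ^ k \in S -> {subset pclosure b <= S}.
Proof.
move=> [_ cb] [bv bk] central Sv.
have single : forall y, y \in supp (core b) -> y = v.
  apply: coconnected1 cb _ => // y yb yv; rewrite adj_sym.
  apply: gen_commute_adj yv; apply/commute_sym/(commuteJ _ _ k)/central.
  by apply: vertex_in_pclosure.
have vk : gen E v ^ k = gen E v ^ conjugator b.
  rewrite -[k](mulgVK (conjugator b)) conjgM; congr (_ ^ _); apply: commute_conjg.
  by apply: commute_sym; apply: (parab_gen_commute _ bk) => y /single ->.
have sub : {subset parab (mem (supp (core b))) <= conjg_pred S (conjugator b)^-1}.
  by apply: sub_parab => y /single ->; rewrite inE invgK -vk.
by move=> h /sub; rewrite inE invgK conjgKV.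
Qed.

Lemma orthogonal_vertex_eq b c v v' k k' : irreducible b -> irreducible c ->
  vertex_in b v k -> vertex_in c v' k' -> orthogonal b c ->
  gen E v ^ k = gen E v' ^ k' -> coaxial b c.
Proof.
move=> ib ic bv cv bc e; split; last exact: orthogonal_commute.
have bP := vertex_in_pclosure bv; have cP := vertex_in_pclosure cv.
move=> h; apply/idP/idP.
  apply: (pclosure_central_vertex ib bv); last by rewrite e.
  by move=> g bg; apply/commute_sym/bc => //; rewrite e.
apply: (pclosure_central_vertex ic cv); last by rewrite -e.
by move=> g cg; apply: bc => //; rewrite -e.
Qed.

Lemma commute_star_retract y s f n : ~~ star E [:: y] s -> 0 < n ->
  commute f (gen E y) -> commute (f ^ (gen E s ^+ n)) (gen E y) -> commute f (gen E s).
Proof.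
move=> ys n_gt0 /commute_sym/(@genX_commute_star _ _ y 1 _ isT)/parabP pf.
move=> /commute_sym/(@genX_commute_star _ _ y 1 _ isT)/parabP.
rewrite gmulfJ gmulfXn /= pf retr_wval /wfilter /= (negbTE ys) wval0 expg1n conjg1 => fs.
by apply/commute_sym/(genX_commute s f n_gt0)/commute_sym/commgP/conjg_fixP.
Qed.

Lemma Ncommute_near y s f : ~ commute f (gen E y) ->
  \forall n \near \oo, ~ commute (f ^ (gen E s ^+ n)) (gen E y).
Proof.
move=> fy; have [ys|ys] := boolP (star E [:: y] s).
  apply: nearW => n /commuteJl; rewrite (@commute_conjg _ (gen E y)) //.
  by apply/commuteV/commuteX/star_commute/gen_parab.
have [[m cm]|N] := pselect (exists m, commute (f ^ (gen E s ^+ m)) (gen E y)); last first.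
  by apply: nearW => n cn; apply: N; exists n.
exists m.+1 => // n /= mn cn; apply: fy.
have /commuteJl : commute (f ^ (gen E s ^+ m)) (gen E s).
  apply: (@commute_star_retract y s _ (n - m)) => //; first by rewrite subn_gt0.
  by rewrite -conjgM -expgnDr subnKC // ltnW.
rewrite (@commute_conjg _ (gen E s)); last exact/commuteV/commuteX/commute_refl.
by move=> fs; rewrite (@commute_conjg _ f) in cn => //; apply: commuteX.
Qed.

Section GenericConjugator.
Variables (S : seq V) (J : finType).
Hypothesis cS : coconnected E S.
Implicit Types F : J -> raag E.

Definition commuting_pairs F : {set J * seq_sub S} :=
  finset (fun p => gen E (val p.2) \in centr (F p.1)).

Lemma commuting_pairsP F j (y : seq_sub S) :
  reflect (commute (F j) (gen E (val y))) ((j, y) \in commuting_pairs F).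
Proof. by rewrite inE /=; apply: (iffP (centrP _ _)); apply: commute_sym. Qed.

(* Conjugation by a large power of s preserves non-commutation with each vertex, and
   spreads it from s to the vertices that are not adjacent to s. *)
Lemma commuting_pairs_proper F :
  (forall j, exists y : seq_sub S, (j, y) \notin commuting_pairs F) ->
  0 < #|commuting_pairs F| -> exists2 s, s \in S &
  exists n, commuting_pairs (fun j => F j ^ (gen E s ^+ n)) \proper commuting_pairs F.
Proof.
move=> NF /card_gt0P[[j0 y0] /commuting_pairsP c0].
have [||s [y [sS yS Ns cy sy]]] := cS (Y := fun y => gen E y \notin centr (F j0)).
- have [y Ny] := NF j0; apply/hasP; exists (val y); first exact: valP.
  by apply: contra Ny => ?; rewrite inE.
- apply/hasP; exists (val y0); first exact: valP.
  by rewrite /= negbK; apply/centrP/commute_sym.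
rewrite negbK in cy; move/centrP/commute_sym: cy => cy.
have ys : ~~ star E [:: y] s.
  rewrite star1E negb_or adj_sym sy andbT; apply: contraNneq Ns => ->.
  exact/centrP/commute_sym.
pose Fn n j := F j ^ (gen E s ^+ n).
have : \forall n \near \oo, forall p,
    p \notin commuting_pairs F -> p \notin commuting_pairs (Fn n).
  apply: filter_forall => -[j z]; have [_|/commuting_pairsP Nz] := boolP (_ \in _).
    exact: nearW.
  near=> n => _; apply/commuting_pairsP; near: n; exact: Ncommute_near.
move=> [N _ HN]; exists s => //; exists N.+1; apply/properP; split.
  by apply/subsetP => p; apply: contraTT; apply: HN; apply: leqnSn.
exists (j0, SeqSub yS); first exact/commuting_pairsP.
apply/commuting_pairsP => /(commute_star_retract ys (ltn0Sn N) cy) c.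
by case/centrP: Ns; apply: commute_sym.
Unshelve. all: by end_near. Qed.

Lemma generic_conjugator F :
  (forall j, exists2 y, y \in S & ~ commute (F j) (gen E y)) ->
  exists2 h, h \in parab (mem S) &
    forall j y, y \in S -> ~ commute (F j ^ h) (gen E y).
Proof.
move=> NF; have {}NF j : exists y : seq_sub S, (j, y) \notin commuting_pairs F.
  by have [y yS Ny] := NF j; exists (SeqSub yS); apply/commuting_pairsP.
have [n] := ubnP #|commuting_pairs F|; elim: n F NF => // n IH F NF Fn.
have [F0|/(commuting_pairs_proper NF)[s sS [m Fm]]] := posnP #|commuting_pairs F|.
  exists 1 => [|j y yS]; first exact: gpred1.
  move=> c; have : (j, SeqSub yS) \in commuting_pairs F.
    by apply/commuting_pairsP; rewrite conjg1 in c.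
  by rewrite (card0_eq F0).
have [||h Sh Nh] := IH (fun j => F j ^ (gen E s ^+ m)).
- move=> j; have [y Ny] := NF j; exists y; apply: contra Ny.
  exact: (subsetP (proper_sub Fm)).
- exact: leq_trans (proper_card Fm) _.
exists (gen E s ^+ m * h); first by rewrite gpredM ?gpredXn ?gen_parab.
by move=> j y yS; rewrite conjgM; apply: Nh.
Qed.

End GenericConjugator.

Lemma generic_vertex_in b v (F : seq (raag E)) : irreducible b -> v \in supp (core b) ->
  {in F, forall f, exists2 g, g \in pclosure b & ~ commute f g} ->
  exists2 k, vertex_in b v k & {in F, forall f, ~ commute f (gen E v ^ k)}.
Proof.
move=> [_ cb] bv NF; set a := conjugator b.
have [|h bh Nh] := @generic_conjugator _ _ cb (fun j : 'I_(size F) => F`_j ^ a^-1).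
  move=> j; have [g bg Ng] := NF _ (mem_nth 1 (ltn_ord j)).
  apply: contra_notP Ng => N; apply/(commuteJ _ _ a^-1)/commute_sym.
  apply: parab_gen_commute bg => y yb; apply: commute_sym.
  by apply: contra_notP N => Ny; exists y.
exists (h^-1 * a); first by split; rewrite // mulgK gpredV.
move=> f /(nthP 1)[j jF <-] c; apply: (Nh (Ordinal jF) v bv) => /=.
by rewrite -conjgM commuteJl invgM invgK.
Qed.

End Closures.

Lemma class_representative (T : choiceType) (R : T -> T -> Prop) :
  (forall i, R i i) -> (forall i j, R i j -> R j i) ->
  (forall i j l, R i j -> R j l -> R i l) ->
  exists rep : T -> T, (forall i, R i (rep i)) /\ forall i j, R i j -> rep i = rep j.
Proof.
move=> Rrefl Rsym Rtrans; exists (fun i => choose (fun j => `[< R i j >]) i).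
split=> [i|i j ij]; first exact/asboolP/(@chooseP _ (fun j => `[< R i j >]))/asboolP.
rewrite (@eq_choose _ _ (fun l => `[< R j l >])).
  by apply: choose_id; apply/asboolP => //; apply: Rsym.
by move=> l; apply/asboolP/asboolP; apply: Rtrans => //; apply: Rsym.
Qed.

Section Replacement.
Variables (V : choiceType) (E : sgraph V) (T : finType) (B : T -> raag E).
Hypothesis irrB : forall i, irreducible (B i).
Local Notation P i := (pclosure (B i)).

Section GenericChoice.
Variables (v : T -> V) (q : T -> T -> raag E).
Hypotheses (v_core : forall i, v i \in supp (core (B i)))
  (q_witness : forall i j, ~ orthogonal (B i) (B j) ->
    q i j \in P i /\ exists2 g, g \in P j & ~ commute (q i j) g).
Implicit Types (s : seq T) (k : T -> raag E).
Local Notation c k i := (gen E (v i) ^ k i).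

Definition generic_on s k :=
  [/\ {in s, forall i, vertex_in (B i) (v i) (k i)},
      {in s &, forall i j, i != j -> ~ orthogonal (B i) (B j) -> ~ commute (c k i) (c k j)}
    & {in s, forall i j, ~ orthogonal (B i) (B j) -> ~ commute (c k i) (q j i)}].

(* The new vertex is chosen not to commute with the previous ones and with the witnesses
   in the other closures. *)
Lemma generic_on_extend i s k :
  i \notin s -> generic_on s k -> exists k', generic_on (i :: s) k'.
Proof.
move=> iNs [kP kN kq].
pose F := [seq c k j | j <- s & `[< ~ orthogonal (B i) (B j) >]] ++
  [seq q j i | j <- enum T & `[< ~ orthogonal (B i) (B j) >]].
have [|ki kiP kiN] := generic_vertex_in (F := F) (irrB i) (v_core i).
  move=> f; rewrite mem_cat => /orP[] /mapP[j];
    rewrite mem_filter => /andP[/asboolP o js] ->.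
    by exists (q i j); [have [] := q_witness o | apply: kq => // /orthogonal_sym].
  by have [|_ [g ig Ng]] := @q_witness j i; [move=> /orthogonal_sym | exists g].
have Fc j : j \in s -> ~ orthogonal (B i) (B j) -> c k j \in F.
  move=> js o; rewrite mem_cat; apply/orP; left; apply/mapP; exists j => //.
  by rewrite mem_filter js andbT; apply/asboolP.
have Fq j : ~ orthogonal (B i) (B j) -> q j i \in F.
  move=> o; rewrite mem_cat; apply/orP; right; apply/mapP; exists j => //.
  by rewrite mem_filter mem_enum andbT; apply/asboolP.
pose k' j := if j == i then ki else k j.
have k'i : k' i = ki by rewrite /k' eqxx.
have k's j : j \in s -> k' j = k j.
  by move=> js; rewrite /k'; case: eqP => // ji; rewrite -ji js in iNs.
exists k'; split=> [j|j l|j]; rewrite !inE.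
- by move=> /predU1P[->|js]; rewrite ?k'i ?k's //; apply: kP.
- move=> /predU1P[->|js] /predU1P[->|ls]; rewrite ?eqxx // => jl o.
  + by rewrite k'i k's // => /commute_sym; apply/kiN/Fc.
  + by rewrite k'i k's //; apply/kiN/Fc => // /orthogonal_sym.
  + by rewrite !k's //; apply: kN.
- move=> /predU1P[->|js] l o; last by rewrite k's //; apply: kq.
  by rewrite k'i => /commute_sym; apply/kiN/Fq.
Qed.

Lemma generic_on_exists s : uniq s -> exists k, generic_on s k.
Proof.
elim: s => [|i s IH] /=; first by exists (fun=> 1).
by move=> /andP[iNs /IH[k]]; apply: generic_on_extend.
Qed.

End GenericChoice.

Lemma generic_vertices : exists (v : T -> V) (k : T -> raag E),
  (forall i, vertex_in (B i) (v i) (k i)) /\ forall i j, i != j ->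
    ~ orthogonal (B i) (B j) -> ~ commute (gen E (v i) ^ k i) (gen E (v j) ^ k j).
Proof.
have [v v_core] := choice (fun i => irreducible_core_neq_nil (irrB i)).
have witness i j : exists g, ~ orthogonal (B i) (B j) ->
    g \in P i /\ exists2 h, h \in P j & ~ commute g h.
  have [o|/Northogonal_witness[g ig Ng]] := pselect (orthogonal (B i) (B j)).
    by exists 1.
  by exists g.
have qP i := projT2 (choice (witness i)).
have [k [kP kN _]] := generic_on_exists v_core qP (enum_uniq T).
by exists v, k; split=> [i|i j]; [apply: kP | apply: kN]; rewrite mem_enum.
Qed.

(* Coaxial elements are replaced by the same conjugate of a vertex. *)
Lemma irreducible_vertices : exists (v : T -> V) (k : T -> raag E),
  let c i := gen E (v i) ^ k i in
  (forall i j, c i = c j -> coaxial (B i) (B j)) /\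
  forall i j, commute (c i) (c j) <-> commute (B i) (B j).
Proof.
have [v [k [vkB vkN]]] := generic_vertices.
have [i|i j|i j l|rep [repR rep_eq]] :=
    @class_representative T (fun i j => coaxial (B i) (B j)).
- exact: coaxial_refl.
- exact: coaxial_sym.
- exact: coaxial_trans.
pose c i := gen E (v i) ^ k i.
have repP i : P i =i P (rep i) by have [] := repR i.
have repN i j : rep i != rep j -> ~ coaxial (B i) (B j).
  by apply: contra_neq_not => /rep_eq.
have c_eq i j : c (rep i) = c (rep j) -> coaxial (B i) (B j).
  move=> e; have [o|o] := pselect (orthogonal (B (rep i)) (B (rep j))).
    apply: coaxial_trans (repR i) _ => //.
    apply: coaxial_trans (coaxial_sym (repR j)) => //.
    exact: orthogonal_vertex_eq (vkB _) (vkB _) o e.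
  have [e'|ne] := eqVneq (rep i) (rep j).
    apply: coaxial_trans (repR i) _ => //; rewrite e'; exact/coaxial_sym.
  by case: (vkN _ _ ne o); rewrite -/(c _) -/(c _) e.
exists (v \o rep), (k \o rep); split=> [i j|i j] /=; first exact: c_eq.
have [o|o] := pselect (orthogonal (B (rep i)) (B (rep j))).
  split=> _; last by apply: o; apply: vertex_in_pclosure (vkB _).
  by apply/orthogonal_commute/(eq_orthogonal _ _ o) => h; rewrite -repP.
have [e|ne] := eqVneq (rep i) (rep j).
  have [_ ij] : coaxial (B i) (B j) by apply: c_eq; rewrite e.
  by rewrite e; split.
split=> [/(vkN _ _ ne o) //|ij].
have [o'|s] := irreducible_commute_closures (irrB i) (irrB j) ij.
  by case: o; apply: eq_orthogonal o'.
by case: (repN i j ne).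
Qed.

End Replacement.

(** * Embeddings by conjugates of powers of vertices *)

Definition vertex_embeds (V V' : choiceType) (E : rel V) (E' : rel V') :=
  exists2 phi : UMagmaMorphism.type (raag E) (raag E'), injective phi &
    forall v, exists x n k, 0 < n /\ phi (gen E v) = (gen E' x ^+ n) ^ k.

Lemma vertex_embeds_trans (V1 V2 V3 : choiceType)
    (E1 : rel V1) (E2 : rel V2) (E3 : rel V3) :
  vertex_embeds E1 E2 -> vertex_embeds E2 E3 -> vertex_embeds E1 E3.
Proof.
move=> [phi phi_inj phi_gen] [psi psi_inj psi_gen].
exists (psi \o phi : UMagmaMorphism.type _ _); first exact: inj_comp.
move=> v; have [x [n [k [n0 /= ->]]]] := phi_gen v.
have [y [m [l [m0 yE]]]] := psi_gen x.
exists y, (m * n)%N, (l * psi k); split; first by rewrite muln_gt0 m0.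
by rewrite gmulfJ gmulfXn yE conjgM expgnA -conjXg.
Qed.

Lemma induced_vertex_embeds (V V' : choiceType) (E : rel V) (E' : rel V') (f : V -> V') :
  injective f -> (forall a b, E' (f a) (f b) = E a b) -> vertex_embeds E E'.
Proof.
move=> finj fE.
have phiC : edge_commute E (gen E' \o f) by move=> a b; rewrite -fE; apply: gen_commute.
pose retract x :=
  if pselect (exists a, f a = x) is left fx then gen E (sval (cid fx)) else 1.
have retractf a : retract (f a) = gen E a.
  rewrite /retract; case: pselect => [fx|[]]; last by exists a.
  by case: cid => b /= /finj ->.
have retractN x : ~ (exists a, f a = x) -> retract x = 1.
  by rewrite /retract; case: pselect.
have retractC : edge_commute E' retract.
  move=> x y; have [[a <-]|/retractN ->] := pselect (exists a, f a = x); last first.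
    by move=> _; apply/commute_sym/commute1.
  have [[b <-]|/retractN -> _] := pselect (exists b, f b = y); last exact: commute1.
  by rewrite fE !retractf; apply: gen_commute.
exists (raag_lift phiC : UMagmaMorphism.type _ _).
  apply: (can_inj (g := raag_lift retractC)) => g.
  pose phi := raag_lift retractC \o raag_lift phiC : UMagmaMorphism.type (raag E) (raag E).
  apply: (eq_raag_morphism (phi := phi) (psi := idfun)) => a.
  by rewrite /= !raag_lift_gen.
by move=> a; exists (f a), 1%N, 1; rewrite /= raag_lift_gen conjg1.
Qed.

Section Double.
Variables (V : choiceType) (E : sgraph V) (v : V) (m : nat).
Implicit Types (u : V) (i j : 'I_m.+1).
Local Notation st := (star E [:: v]).

(* The (m+1)-fold double of E along the star of v: the vertices outside the star have m+1
   copies, the others only the copy of index 0. *)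
Definition double_vertex := {p : V * 'I_m.+1 | st p.1 ==> (p.2 == ord0)}.
HB.instance Definition _ := Choice.on double_vertex.
Implicit Types p q : double_vertex.

Fact copy_subproof u i :
  st (u, if st u then ord0 else i).1 ==> ((u, if st u then ord0 else i).2 == ord0).
Proof. by rewrite /=; case: (st u). Qed.
Definition copy u i : double_vertex :=
  Sub (u, if st u then ord0 else i) (copy_subproof u i).

Lemma copyK p : copy (val p).1 (val p).2 = p.
Proof.
apply: val_inj; case: p => -[u i] /=.
by case: (st u) => //= /eqP ->.
Qed.

Lemma copy_star u i j : st u -> copy u i = copy u j.
Proof. by move=> su; apply: val_inj; rewrite /= su. Qed.

Lemma star_center : st v. Proof. by rewrite star1E eqxx. Qed.

Definition double_adj : rel double_vertex := fun p q =>
  (st (val p).1 || st (val q).1 || ((val p).2 == (val q).2)) && E (val p).1 (val q).1.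

Lemma double_adj_sym : symmetric double_adj.
Proof. by move=> p q; rewrite /double_adj adj_sym (orbC (st _)) (eq_sym (val p).2). Qed.

Lemma double_adj_irr : irreflexive double_adj.
Proof. by move=> p; rewrite /double_adj adj_irr andbF. Qed.

Definition double : sgraph double_vertex := SGraph double_adj_sym double_adj_irr.

Lemma double_copy a b i : E a b -> double (copy a i) (copy b i).
Proof.
by rewrite /= /double_adj /= => ->; case: (st a); case: (st b); rewrite //= eqxx.
Qed.

Definition double_gen p : raag E :=
  (gen E (val p).1 ^+ (if (val p).1 == v then m.+1 else 1%N)) ^ (gen E v ^+ (val p).2).

Lemma star_conj u n : st u -> gen E u ^ (gen E v ^+ n) = gen E u.
Proof.
by move=> su; apply/commute_conjg/commuteX/commute_sym/star_commute/gen_parab.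
Qed.

Lemma double_gen_copy u i : double_gen (copy u i) =
  (gen E u ^+ (if u == v then m.+1 else 1%N)) ^ (gen E v ^+ i).
Proof.
rewrite /double_gen /=; case: (boolP (st u)) => // su.
by rewrite /= conjg1 conjXg star_conj.
Qed.

Lemma double_gen_commute : edge_commute double double_gen.
Proof.
have same_copy a b i : E a b -> commute (double_gen (copy a i)) (double_gen (copy b i)).
  by move=> ab; rewrite !double_gen_copy commuteJ; apply/commuteX2/gen_commute.
move=> p q; rewrite -(copyK p) -(copyK q); move: (val p) (val q) => [a i] [b j].
rewrite /= /double_adj /= => /andP[H ab].
case: (boolP (st a)) H => [sa _|_].
  by rewrite (copy_star i j sa); apply: same_copy.
case: (boolP (st b)) => [sb _|_ /= /eqP ->]; last exact: same_copy.
by rewrite (copy_star j i sb); apply: same_copy.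
Qed.

Definition double_hom : raag double -> raag E := raag_lift double_gen_commute.
HB.instance Definition _ := UMagmaMorphism.copy double_hom (raag_lift double_gen_commute).

Lemma double_hom_gen p : double_hom (gen double p) = double_gen p.
Proof. exact: raag_lift_gen. Qed.

Local Notation state := (raag double * 'I_m.+1)%type.

(* The group of E acts on the right of raag double x Z/(m+1) in such a way that
   [double_hom h] translates the fibre over 0 by h; it is the action induced from a
   subgroup of index m+1. *)
Definition double_step (s : state) (l : letter V) : state :=
  if l.1 == v then
    if l.2 then ((if s.2 == ord_max then s.1 / gen double (copy v ord0) else s.1), ordS s.2)
    else ((if s.2 == ord0 then s.1 * gen double (copy v ord0) else s.1), ord_pred s.2)
  else (s.1 * lval double (copy l.1 s.2, l.2), s.2).

Lemma ordS_eq0 i : (ordS i == ord0) = (i == ord_max).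
Proof.
have -> : ord0 = ordS (ord_max : 'I_m.+1) by apply: val_inj; rewrite /= modnn.
exact: (inj_eq (can_inj (@ordSK _))).
Qed.

Lemma ord_pred_eq_max i : (ord_pred i == ord_max) = (i == ord0).
Proof. by rewrite -ordS_eq0 ord_predK. Qed.

Lemma double_stepK u b s : double_step (double_step s (u, b)) (u, ~~ b) = s.
Proof.
rewrite /double_step /=; case: s => g i /=.
have [_|_] := eqVneq u v; last by rewrite -mulgA lvalN mulgV mulg1.
case: b => /=.
  by rewrite ordS_eq0 ordSK; case: (i == ord_max); rewrite ?mulgVK.
by rewrite ord_pred_eq_max ord_predK; case: (i == ord0); rewrite ?mulgK.
Qed.

Lemma double_step_center a s : E v a ->
  double_step (double_step s (v, false)) (a, false) =
  double_step (double_step s (a, false)) (v, false).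
Proof.
move=> va; have sa : st a by rewrite star1E va orbT.
have av : a == v = false by apply: contraTF va => /eqP ->; rewrite adj_irr.
rewrite /double_step /= av eqxx; case: s => g i /=.
rewrite (copy_star i ord0 sa) (copy_star (ord_pred i) ord0 sa) /lval /=.
congr (_, _); case: (i == ord0) => //; rewrite -!mulgA; congr (_ * _).
exact/gen_commute/double_copy.
Qed.

Lemma double_stepC a b s : E a b ->
  double_step (double_step s (a, false)) (b, false) =
  double_step (double_step s (b, false)) (a, false).
Proof.
have [->|av] := eqVneq a v; first exact: double_step_center.
have [->|bv ab] := eqVneq b v.
  by rewrite adj_sym => /double_step_center ->.
rewrite /double_step /= (negbTE av) (negbTE bv) /lval /= -!mulgA; congr (_ * _, _).
exact/gen_commute/double_copy.
Qed.

Local Notation act := (@raag_act _ E _ double_step).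
Local Notation actM := (raag_actM double_stepK double_stepC).
Local Notation act_gen := (raag_act_gen double_stepK double_stepC).
Local Notation act1 := (raag_act1 double_stepK double_stepC).
Local Notation actV := (raag_actV double_stepK double_stepC).

Lemma act_center_exp i g : act (g, i) (gen E v ^+ i) = (g, ord0).
Proof.
have [n ni] : exists n : nat, n = i by exists i.
rewrite -ni; elim: n i ni => [|n IH] i ni.
  by rewrite act1; congr (_, _); apply: val_inj.
rewrite expgS actM act_gen /double_step /= eqxx.
have -> : i == ord0 = false by rewrite -val_eqE /= -ni.
apply: IH; rewrite /= -ni addSn /= modnDr modn_small //.
by rewrite ltnW // ni ltn_ord.
Qed.

Lemma act_double_gen p g : act (g, ord0) (double_gen p) = (g * gen double p, ord0).
Proof.
rewrite -(copyK p); move: (val p) => [u i] /=; rewrite double_gen_copy.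
have [->|uv] := eqVneq u v.
  rewrite conjXg star_conj ?star_center // expgS actM act_gen /double_step /= eqxx.
  rewrite (copy_star i ord0 star_center).
  have -> : ord_pred (ord0 : 'I_m.+1) = ord_max by apply/eqP; rewrite ord_pred_eq_max.
  exact: (act_center_exp ord_max).
rewrite conjgE expg1 !actM (actV (act_center_exp i g)) act_gen /double_step /= (negbTE uv).
by rewrite /lval /= act_center_exp.
Qed.

Lemma act_double_hom h g : act (g, ord0) (double_hom h) = (g * h, ord0).
Proof.
rewrite -(wreprK h); elim: (wrepr h) g => [|[p b] w IH] g.
  by rewrite wval0 gmulf1 act1 mulg1.
rewrite wval_cons gmulfM actM mulgA -IH; congr raag_act.
by case: b; rewrite /lval /= ?gmulfV /= double_hom_gen; [apply: actV|];
  rewrite act_double_gen ?mulgVK.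
Qed.

Lemma double_hom_inj : injective double_hom.
Proof.
by move=> g h e; have := act_double_hom g 1; rewrite e act_double_hom !mul1g => -[].
Qed.

Lemma double_vertex_embeds : vertex_embeds double E.
Proof.
exists (double_hom : UMagmaMorphism.type _ _) => [|p]; first exact: double_hom_inj.
exists (val p).1, (if (val p).1 == v then m.+1 else 1%N), (gen E v ^+ (val p).2).
by split; [case: ifP | apply: double_hom_gen].
Qed.

End Double.

Section Unwind.
Variables (V : choiceType) (E : sgraph V) (v : V).
Implicit Types (k : word V) (m n B : nat).

Lemma unwind_word m B k : size k <= B -> B + B <= m ->
  exists e (w : word (double_vertex E v m)),
    [/\ e <= B + size k, B <= e + size k, size w = count (predC1 v) (supp k)
      & wval E k * gen E v ^+ B = gen E v ^+ e * double_hom (wval (double E v m) w)].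
Proof.
move=> kB Bm; elim: k kB => [|[u b] k IH] kB.
  exists B, [::]; rewrite !addn0; split=> //.
  by rewrite !wval0 mul1g gmulf1 mulg1.
have [e [w [e1 e2 sw ek]]] := IH (ltnW kB).
have [uv|uv] := eqVneq u v; last first.
  exists e, ((copy E v u (inord e), b) :: w).
  split; [by rewrite /= addnS leqW| by rewrite /= addnS leqW| by rewrite /= sw uv|].
  have em : e < m.+1.
    rewrite ltnS; apply: leq_trans e1 _; apply: leq_trans Bm.
    by rewrite leq_add2l ltnW.
  rewrite wval_cons -mulgA ek wval_cons gmulfM !mulgA; congr (_ * _).
  have homu : double_hom (lval (double E v m) (copy E v u (inord e), b)) =
      lval E (u, b) ^ (gen E v ^+ e).
    by case: b {kB}; rewrite /lval /= ?gmulfV /= double_hom_gen double_gen_copy (negbTE uv)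
      inordK ?conjVg.
  by rewrite /= homu -conjgC.
rewrite {u}uv in kB *; case: b kB => kB.
  case: e => [|e] in e1 e2 ek *; first by move: (leq_trans kB e2); rewrite /= ltnn.
  exists e, w; split; first by rewrite /= addnS leqW // ltnW.
  - by rewrite /= addnS -addSn.
  - by rewrite /= eqxx.
  by rewrite wval_cons -mulgA ek /lval /= expgS -mulgA mulKg.
exists e.+1, w; split; first by rewrite /= addnS ltnS.
- by rewrite /= addSn addnS leqW // leqW.
- by rewrite /= eqxx.
by rewrite wval_cons -mulgA ek /lval /= expgS mulgA.
Qed.

(* Doubling along the star of v deletes v from the conjugating words. *)
Lemma unwind_family (I : finType) (k : I -> word V) (x : I -> V) :
  exists m (k' : I -> word (double_vertex E v m)) (x' : I -> double_vertex E v m),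
  let c i := gen E (x i) ^ wval E (k i) in
  let c' i := gen (double E v m) (x' i) ^ wval (double E v m) (k' i) in
  [/\ forall i, size (k' i) = count (predC1 v) (supp (k i)),
      forall i j, c' i = c' j -> c i = c j
    & forall i j, commute (c' i) (c' j) <-> commute (c i) (c j)].
Proof.
pose B := \max_i size (k i); pose m := (B + B)%N; exists m.
have unwind i : exists p : nat * word (double_vertex E v m),
    [/\ p.1 <= m, size p.2 = count (predC1 v) (supp (k i))
      & wval E (k i) * gen E v ^+ B =
        gen E v ^+ p.1 * double_hom (wval (double E v m) p.2)].
  have kB : size (k i) <= B by apply: leq_bigmax.
  have [e [w [e1 _ sw ek]]] := unwind_word kB (leqnn m).
  by exists (e, w); split=> //=; apply: leq_trans e1 _; rewrite leq_add2l.
have [p pP] := choice unwind.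
pose k' i := (p i).2; pose x' i := copy E v (x i) (inord (p i).1 : 'I_m.+1).
exists k', x'; move=> c c'; pose a i := if x i == v then m.+1 else 1%N.
have a_gt0 i : 0 < a i by rewrite /a; case: ifP.
have homc' i : double_hom (c' i) = (c i ^+ a i) ^ (gen E v ^+ B).
  have [pm _ ek] := pP i; rewrite gmulfJ /= double_hom_gen double_gen_copy inordK //.
  by rewrite -conjgM -ek conjgM /c -!conjXg.
split=> [i|i j e|i j]; first by have [] := pP i.
  have xij : x i = x j by have /(congr1 val)[] := gen_conj_inj e.
  have := congr1 (@double_hom _ _ _ _) e; rewrite !homc' => /conjg_inj.
  by rewrite /a /c xij; apply: conj_genX_inj; case: ifP.
rewrite -(gmulf_inj_commute _ _ (@double_hom_inj _ E v m)) /= !homc' commuteJ.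
exact: conj_genX_commute2.
Qed.

End Unwind.

Lemma eq_vertex_embeds (V V' : choiceType) (E1 E2 : rel V) (E' : rel V') :
  E1 =2 E2 -> vertex_embeds E1 E' -> vertex_embeds E2 E'.
Proof.
move=> E12; apply: vertex_embeds_trans.
exact: (@induced_vertex_embeds _ _ _ _ id).
Qed.

Section Inflation.
Variable (V : finType).
Implicit Types (E : sgraph V) (n : nat).

Lemma inflation_sym E n : symmetric (@inflation V E n).
Proof.
by move=> p q; rewrite /inflation eq_sym; case: eqP => _; [rewrite eq_sym|rewrite adj_sym].
Qed.

Lemma inflation_irr E n : irreflexive (@inflation V E n).
Proof. by move=> p; rewrite /inflation !eqxx. Qed.

Definition inflated E n : sgraph (V * 'I_n)%type :=
  SGraph (inflation_sym E (n := n)) (inflation_irr E (n := n)).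

Lemma star_inflated E n (v u : V) (c j : 'I_n) :
  star (inflated E n) [:: (v, c)] (u, j) = star E [:: v] u.
Proof.
rewrite !star1E /= /inflation /= -pair_eqE /= [v == u]eq_sym.
by case: (u == v) => //=; rewrite eq_sym orbN.
Qed.

HB.instance Definition _ E v m := Finite.copy (double_vertex E v m)
  {p : V * 'I_m.+1 | star E [:: v] p.1 ==> (p.2 == ord0)}.

End Inflation.

Lemma inflated_double_embeds (V : finType) (E : sgraph V) (v : V) (m n : nat) (c : 'I_n) :
  vertex_embeds (inflated (double E v m) n) (inflated E n).
Proof.
apply: vertex_embeds_trans (double_vertex_embeds (inflated E n) (v, c) m).
pose f (p : double_vertex E v m * 'I_n) :=
  copy (inflated E n) (v, c) ((val p.1).1, p.2) (val p.1).2.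
have valf p : val (f p) = ((val p.1).1, p.2, (val p.1).2).
  case: p => p j; rewrite -(copyK p) /f /= star_inflated.
  by case: (star E [:: v] _).
apply: (@induced_vertex_embeds _ _ _ _ f).
  move=> [p j] [q l] /(congr1 val); rewrite !valf /= => -[e1 -> e2].
  congr (_, _); apply: val_inj.
  by rewrite [LHS]surjective_pairing e1 e2 -surjective_pairing.
move=> [p j] [q l]; rewrite /= /double_adj !valf /= !star_inflated /inflation /=.
have -> : (p == q) = (val p == val q) by rewrite (inj_eq val_inj).
case: p q => [[u i] /= pi] [[u' i'] /= pi']; rewrite xpair_eqE /double_adj /=.
have [uu'|uu'] := eqVneq u u' => //=.
rewrite uu' in pi *.
case: (boolP (star E [:: v] u')) pi pi' => /= [_ /eqP -> /eqP -> //=|_ _ _].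
by case: (eqVneq i i').
Qed.

(* Repeated doubling shortens all the conjugating words until only vertices remain. *)
Lemma conj_vertices_embed (I V : finType) (E : sgraph V) n
    (k : I -> word V) (x : I -> V) (col : I -> 'I_n) :
  let c i := gen E (x i) ^ wval E (k i) in
  (forall i j, c i = c j -> col i = col j -> i = j) ->
  vertex_embeds (commgraph c) (inflated E n).
Proof.
have [N] := ubnP (\sum_i size (k i)); elim: N V E k x => // N IH V E k x kN c c_inj.
have [k0|/forallPn[i0 /supp_neq_nil[v vk]]] := boolP [forall i, k i == [::]].
  have cE i : c i = gen E (x i) by rewrite /c (eqP (forallP k0 i)) wval0 conjg1.
  apply: (@induced_vertex_embeds _ _ _ _ (fun i => (x i, col i))).
    by move=> i j [xij]; apply: c_inj; rewrite !cE xij.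
  move=> i j; rewrite /= /inflation /=; have [xij|xij] := eqVneq (x i) (x j).
    apply/idP/commgraph_adjP => [cij|[ij _]].
      by rewrite !cE xij; split=> // ij; rewrite ij eqxx in cij.
    by apply/eqP => cij; apply/ij/c_inj; rewrite // !cE xij.
  apply/idP/commgraph_adjP; rewrite !cE; last by move=> [_ /gen_commute_adj]; apply.
  by move=> xE; split; [move=> ij; rewrite ij eqxx in xij | apply: gen_commute].
have [m [k' [x' [size_k' c'_inj c'C]]]] := unwind_family E v k x.
apply: vertex_embeds_trans (inflated_double_embeds E v m (col i0)).
set c' := fun i => gen (double E v m) (x' i) ^ wval (double E v m) (k' i).
apply: (@eq_vertex_embeds _ _ (commgraph c')).
  by move=> i j; apply/commgraph_adjP/commgraph_adjP => -[ij /c'C].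
apply: IH => [|i j /c'_inj]; last exact: c_inj.
rewrite (eq_bigr _ (fun i _ => size_k' i)).
apply: leq_trans (_ : \sum_i size (k i) <= N) => //.
rewrite (bigD1 i0) //= [X in _ < X](bigD1 i0) //= -addSn leq_add //.
  rewrite -size_supp -(count_predC (pred1 v)) -[X in X < _]add0n ltn_add2r.
  by rewrite -has_count has_pred1.
by apply: leq_sum => i _; rewrite -size_supp count_size.
Qed.

(** * Factorization into commuting irreducible elements *)

Section Factorization.
Variables (V : choiceType) (E : sgraph V).
Implicit Types (u w : word V) (Y Z : pred V) (g h : raag E).

Lemma size_wfilter_lt Y w : has (predC Y) (supp w) -> size (wfilter Y w) < size w.
Proof. by rewrite has_predC ltnNge; apply: contra; apply: size_wfilter_eq. Qed.

Section Split.
Variables (w : word V) (Y Z : pred V).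
Hypotheses (YZ : joined E Y Z) (cw : cyc_reduced E w) (YZw : all (predU Y Z) (supp w)).

Lemma wval_split : wval E w = wval E (wfilter Y w) * wval E (wfilter Z w).
Proof. by rewrite -!retr_wval; apply: parab_join_split => //; apply: wval_parab. Qed.

Lemma size_split : size w = (size (wfilter Y w) + size (wfilter Z w))%N.
Proof.
rewrite !size_filter -count_predUI [X in _ = (_ + X)%N](_ : _ = 0).
  by rewrite addn0; apply/esym/eqP; rewrite -all_count; move: YZw; rewrite all_map.
apply/eqP; rewrite eqn0Ngt -has_count -all_predC; apply/allP => l _ /=.
by apply/negP => /andP[/(joined_disjoint YZ)/negP].
Qed.

Lemma cyc_reduced_split : cyc_reduced E (wfilter Y w).
Proof.
move=> u g e; pose h := retr Y g.
have Yw : wval E (wfilter Y w) \in parab Y.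
  by apply: wval_parab; rewrite supp_wfilter filter_all.
have eY : wval E (wfilter Y u) = wval E (wfilter Y w) ^ h.
  by rewrite -retr_wval e gmulfJ /= (parabP _ _ Yw).
have Zh : commute (wval E (wfilter Z w)) h.
  apply: commute_sym; apply: (parab_commute YZ); first exact: retr_parab.
  by apply: wval_parab; rewrite supp_wfilter filter_all.
have := @cw (wfilter Y u ++ wfilter Z w) h.
rewrite wval_cat eY {1}wval_split conjMg (commute_conjg Zh) => /(_ erefl).
rewrite size_split size_cat leq_add2r => le; apply: leq_trans le _.
by rewrite size_filter count_size.
Qed.

Lemma commute_split h : commute (wval E w) h -> commute (wval E (wfilter Y w)) h.
Proof.
move=> wh; pose s := retr (mem (supp w)) h; pose l := retr (link E (supp w)) h.
have hE : h = s * l.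
  by apply/parab_join_split/(@cyc_reduced_commute_star _ _ w 1) => //; apply: link_joined.
have lC g : g \in parab (mem (supp w)) -> commute g l.
  by move=> wg; apply: parab_commute (@link_joined _ _ _) wg (retr_parab _ _).
have ws : commute (wval E w) s.
  have -> : s = h / l by rewrite hE mulgK.
  by apply: commuteM => //; apply/commuteV/lC/parab_supp.
have Yw : wval E (wfilter Y w) \in parab Y.
  by apply: wval_parab; rewrite supp_wfilter filter_all.
rewrite hE; apply: commuteM; last first.
  apply/lC/wval_parab/allP => y; rewrite supp_wfilter mem_filter.
  by case/andP.
rewrite (parab_join_split YZ (g := s)); last first.
  by apply: parabS (retr_parab _ _) => y; apply: (allP YZw).
apply: commuteM; last exact: parab_commute YZ Yw (retr_parab _ _).
by rewrite -retr_wval; apply: gmulf_commute.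
Qed.

End Split.

Lemma Ncoconnected_join s : ~ coconnected E s -> exists Y Z,
  [/\ joined E Y Z, all (predU Y Z) s, has Y s & has Z s].
Proof.
move=> /existsNP[Y /not_implyP[hY /not_implyP[hNY N]]].
exists [pred v | (v \in s) && Y v], [pred v | (v \in s) && ~~ Y v]; split.
- move=> y z /andP[ys Yy] /andP[zs NYz]; apply: contra_notT N => Nyz.
  by exists y, z.
- by apply/allP => y ys; rewrite /= ys; case: (Y y).
- by case/hasP: hY => y ys Yy; apply/hasP; exists y; rewrite //= ys.
- by case/hasP: hNY => y ys Yy; apply/hasP; exists y; rewrite //= ys.
Qed.

Definition coconnected_factors w (ws : seq (word V)) :=
  [/\ {in ws, forall u, [/\ cyc_reduced E u, coconnected E (supp u), u != [::]
        & {subset supp u <= supp w}]},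
      wval E w = \prod_(u <- ws) wval E u,
      pairwise (allrel E) [seq supp u | u <- ws]
    & forall h, commute (wval E w) h -> {in ws, forall u, commute (wval E u) h}].

Lemma coconnected_factors_cat w Y Z ws1 ws2 :
  joined E Y Z -> cyc_reduced E w -> all (predU Y Z) (supp w) ->
  coconnected_factors (wfilter Y w) ws1 -> coconnected_factors (wfilter Z w) ws2 ->
  coconnected_factors w (ws1 ++ ws2).
Proof.
move=> YZ cw YZw [ws1P prod1 join1 comm1] [ws2P prod2 join2 comm2].
have ZY := joined_sym YZ.
have ZYw : all (predU Z Y) (supp w) by apply: sub_all YZw => v; rewrite /= orbC.
have suppP A u : {subset supp u <= supp (wfilter A w)} ->
    {subset supp u <= supp w} /\ forall y, y \in supp u -> A y.
  by move=> uA; split=> y /uA; rewrite supp_wfilter mem_filter => /andP[].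
split.
- by move=> u; rewrite mem_cat => /orP[/ws1P|/ws2P] [cu iu u0 /suppP[]].
- by rewrite big_cat -prod1 -prod2 (wval_split YZ).
- rewrite map_cat pairwise_cat join1 join2 !andbT; apply/allrelP.
  move=> _ _ /mapP[u /ws1P[_ _ _ /suppP[_ Yu]] ->] /mapP[u' /ws2P[_ _ _ /suppP[_ Zu']] ->].
  by apply/allrelP => y z /Yu Yy /Zu'; apply: YZ.
- move=> h wh u; rewrite mem_cat => /orP[]; [apply: comm1 | apply: comm2].
    exact: (commute_split YZ).
  exact: (commute_split ZY).
Qed.

Lemma cyc_reduced_factorization w :
  cyc_reduced E w -> exists ws, coconnected_factors w ws.
Proof.
have [n] := ubnP (size w); elim: n w => // n IH w wn cw.
have [->|w0] := eqVneq w [::]; first by exists [::]; split; rewrite ?big_nil.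
have [iw|/Ncoconnected_join[Y [Z [YZ YZw hY hZ]]]] := pselect (coconnected E (supp w)).
  by exists [:: w]; split=> [u||//|h wh u]; rewrite ?big_seq1 // inE => /eqP -> //; split.
have ZY := joined_sym YZ.
have ZYw : all (predU Z Y) (supp w) by apply: sub_all YZw => v; rewrite /= orbC.
have lt A B : joined E A B -> has A (supp w) -> size (wfilter B w) < n.
  move=> AB /(sub_has (fun v => joined_disjoint (y := v) AB)) hB.
  by apply: leq_trans (size_wfilter_lt hB) _.
have [ws1 ws1P] := IH _ (lt _ _ ZY hZ) (cyc_reduced_split YZ cw YZw).
have [ws2 ws2P] := IH _ (lt _ _ YZ hY) (cyc_reduced_split ZY cw ZYw).
by exists (ws1 ++ ws2); apply: coconnected_factors_cat YZ cw YZw _ _.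
Qed.

Lemma joined_Ncoaxial u w k : cyc_reduced E u -> cyc_reduced E w -> u != [::] ->
  allrel E (supp u) (supp w) -> ~ coaxial (wval E u ^ k) (wval E w ^ k).
Proof.
move=> cu cw /supp_neq_nil[y yu] /allrelP uw [/(_ (gen E y ^ k))].
rewrite !pclosureE // !conjg_predJ gen_parab // => /esym.
move=> /(geodesic_parab (cyc_reduced_geodesic (@cyc_reduced_gen _ E y))) /=.
by rewrite andbT => /(uw y y yu); rewrite adj_irr.
Qed.

End Factorization.

Lemma pairwise_joined_size (V : finType) (E : sgraph V) (ss : seq (seq V)) :
  [::] \notin ss -> pairwise (allrel E) ss -> size ss <= #|V|.
Proof.
case: ss => [//|[|x0 s0] ss]; first by rewrite mem_head.
set ts := _ :: ss => ts0 join; have uts : uniq (map (head x0) ts).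
  rewrite uniq_pairwise pairwise_map.
  apply: (@sub_in_pairwise _ (fun s => s != [::]) _ _ _ ts _ join); last first.
    by apply/allP => s; apply: contraTneq => ->.
  move=> [|x s] [|y t] //= _ _ /allrelP/(_ x y (mem_head _ _) (mem_head _ _)) /=.
  by apply: contraTneq => ->; rewrite adj_irr.
by rewrite -(size_map (head x0)) -(card_uniqP uts) max_card.
Qed.

Lemma irreducible_factorization (V : finType) (E : sgraph V) (g : raag E) :
  exists bs : seq (raag E),
  [/\ {in bs, forall b, irreducible b}, g = \prod_(b <- bs) b, size bs <= #|V|,
      pairwise (fun b c => `[< ~ coaxial b c >]) bs
    & forall h, commute g h -> {in bs, forall b, commute b h}].
Proof.
have [w [k [-> cw]]] := cyc_reduced_repr g.
have [ws [wsP prodw join comm]] := cyc_reduced_factorization cw.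
exists [seq wval E u ^ k | u <- ws]; split.
- by move=> _ /mapP[u /wsP[cu iu u0 _] ->]; apply/(irreducible_conj k cu).
- by rewrite big_map prodw conjg_prod.
- rewrite size_map -(size_map (@supp V)); apply: pairwise_joined_size join.
  by apply/mapP => -[u /wsP[_ _ u0 _]]; case: (u) u0.
- rewrite pairwise_map; move: join; rewrite pairwise_map.
  apply: (@sub_in_pairwise _ [pred u | u \in ws]); last exact/allP.
  move=> u u' /wsP[cu _ u0 _] /wsP[cu' _ _ _] uu'; apply/asboolP.
  exact: joined_Ncoaxial.
- move=> h /commuteJl wh _ /mapP[u uws ->]; apply/commuteJl; exact: comm uws.
Qed.

(** * Existential sentences *)

Section Sentences.
Variable X : finType.

Definition word_term (u : word X) : gterm :=
  foldr (fun l t => TMul (if l.2 then TInv (TVar (enum_rank l.1))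
    else TVar (enum_rank l.1)) t) TOne u.

Lemma teval_word_term (V : eqType) (env : nat -> word V) u :
  teval env (word_term u) = extend (fun x => env (enum_rank x)) u.
Proof. by elim: u => [|[x b] u IH] //=; rewrite IH /extend /=; case: b. Qed.

Definition conj_formula (A : eqType) (F : A -> qformula) (s : seq A) : qformula :=
  foldr (fun a f => QAnd (F a) f) QTrue s.

Lemma qsat_conj (V : eqType) (E : rel V) env (A : eqType) (F : A -> qformula) s :
  qsat E env (conj_formula F s) <-> {in s, forall a, qsat E env (F a)}.
Proof.
elim: s => [|a s IH] /=; first by split.
split=> [[Fa /IH Fs] b|Fs]; first by rewrite inE => /predU1P[->|/Fs].
split; first by apply: Fs; rewrite mem_head.
by apply/IH => b bs; apply: Fs; rewrite inE bs orbT.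
Qed.

Definition vertex_env (i : nat) : word X :=
  if [pick x | enum_rank x == i :> nat] is Some x then [:: (x, false)] else [::].

Lemma extend_vertex_env u : extend (fun x => vertex_env (enum_rank x)) u = u.
Proof.
have envE x : vertex_env (enum_rank x) = [:: (x, false)].
  rewrite /vertex_env; case: pickP => [y /eqP/val_inj/enum_rank_inj -> //|/(_ x)].
  by rewrite eqxx.
elim: u => [|[x b] u IH] //; rewrite /extend /= in IH *.
by rewrite IH envE; case: b.
Qed.

End Sentences.

Lemma discriminating_hom (VD : finType) (ED : rel VD) (V : eqType) (E : rel V)
    (A : finType) (p : A -> word VD * word VD) : th_ex_sub ED E ->
  exists2 psi : VD -> word V, is_hom ED E psi &
    forall a, ~ raag_eq ED (p a).1 (p a).2 ->
      ~ raag_eq E (extend psi (p a).1) (extend psi (p a).2).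
Proof.
move=> sub.
pose comm (q : VD * VD) := QEq (word_term [:: (q.1, false); (q.2, false)])
  (word_term [:: (q.2, false); (q.1, false)]).
pose neq (a : A) := QNot (QEq (word_term (p a).1) (word_term (p a).2)).
pose f := QAnd (conj_formula comm [seq q <- enum {: VD * VD} | ED q.1 q.2])
  (conj_formula neq [seq a <- enum A | `[< ~ raag_eq ED (p a).1 (p a).2 >]]).
have [|env [/qsat_conj commP /qsat_conj neqP]] := sub f.
  exists (@vertex_env VD); split; apply/qsat_conj => q; rewrite mem_filter => /andP[H _].
    rewrite /comm; cbn [qsat]; rewrite !teval_word_term !extend_vertex_env.
    exact: (@re_step _ ED [::] _ _ [::] (rs_comm H)).
  by rewrite /neq; cbn [qsat]; rewrite !teval_word_term !extend_vertex_env; apply/asboolP.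
exists (fun x => env (enum_rank x)) => [x y xy|a Na].
  have := commP (x, y); rewrite mem_filter mem_enum andbT => /(_ xy).
  by rewrite /comm; cbn [qsat]; rewrite !teval_word_term /extend /= !cats0.
have := neqP a; rewrite mem_filter mem_enum andbT => /(_ (asboolT Na)).
by rewrite /neq; cbn [qsat]; rewrite !teval_word_term.
Qed.

Lemma wval_extend (V V' : choiceType) (E' : rel V') (f : V -> word V') u :
  wval E' (extend f u) = weval (fun x => wval E' (f x)) u.
Proof.
elim: u => [|[x b] u IH]; first by rewrite weval0.
by rewrite weval_cons -IH /extend /= wval_cat; case: b; rewrite //= wval_winv.
Qed.

Lemma weval_extend (V V' : choiceType) (H : groupType) (f : V -> word V') (y : V' -> H) u :
  weval y (extend f u) = weval (fun x => weval y (f x)) u.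
Proof.
elim: u => [|[x b] u IH]; first by rewrite !weval0.
by rewrite weval_cons -IH /extend /= weval_cat; case: b; rewrite //= weval_winv.
Qed.

(* Among the finitely many maps [f t], psi only factors through injective ones. *)
Lemma discriminating_factorization (VD : finType) (ED : rel VD) (V : choiceType)
    (E : rel V) (T : finType) (I : T -> choiceType) (EI : forall t, rel (I t))
    (f : forall t, VD -> word (I t)) :
  th_ex_sub ED E -> exists2 psi : VD -> word V, is_hom ED E psi &
    forall t (B : I t -> raag E), edge_commute (EI t) B ->
      (forall x, weval B (f t x) = wval E (psi x)) -> is_injective_hom ED (EI t) (f t).
Proof.
move=> sub; pose collapses t (q : word VD * word VD) :=
  raag_eq (EI t) (extend (f t) q.1) (extend (f t) q.2) /\ ~ raag_eq ED q.1 q.2.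
have witness t : exists q, (exists q', collapses t q') -> collapses t q.
  have [[q tq]|Nt] := pselect (exists q, collapses t q); first by exists q.
  by exists ([::], [::]).
have [p pP] := choice witness; have [psi psi_hom psiP] := discriminating_hom p sub.
exists psi => // t B BC Bf u w eq_uw; apply: contrapT => Nuw.
have [|/(weval_raag_eq BC) eq_p /psiP[]] := pP t; first by exists (u, w).
by apply/wvalP; rewrite !wval_extend -!(eq_weval Bf) -!weval_extend.
Qed.

(** * The tame embedding *)

Section Fibers.
Variables (VD : finType) (n : VD -> nat).

Definition slot := {x : VD & 'I_(n x)}.
HB.instance Definition _ := Finite.on slot.

Definition fiber x : seq slot := [seq Tagged (fun x => 'I_(n x)) j | j <- enum 'I_(n x)].

Lemma mem_fiber x i : (i \in fiber x) = (tag i == x).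
Proof.
apply/mapP/eqP => [[j _ ->] //|]; case: i => y j /= yx.
by case: x / yx; exists j; rewrite ?mem_enum.
Qed.

Lemma fiber_uniq x : uniq (fiber x).
Proof.
rewrite map_inj_uniq ?enum_uniq // => j l /eqP.
by rewrite -tag_eqE /tag_eq /= eqxx tagged_asE => /eqP.
Qed.

End Fibers.

Definition clique_word (I : Type) (s : seq I) : seq (I * bool) := [seq (i, false) | i <- s].

Lemma weval_clique_word (I : choiceType) (H : groupType) (B : I -> H) s :
  weval B (clique_word s) = \prod_(i <- s) B i.
Proof. by rewrite /weval big_map. Qed.

(* There are finitely many graphs on the slots when the fibers are bounded. *)
Lemma discriminating_fibers (VD : finType) (ED : rel VD) (V : choiceType) (E : rel V)
    (M : nat) : th_ex_sub ED E ->
  exists2 psi : VD -> word V, is_hom ED E psi &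
    forall (n : VD -> nat) (EI : rel (slot n)) (B : slot n -> raag E),
      (forall x, n x <= M) -> edge_commute EI B ->
      (forall x, \prod_(i <- fiber n x) B i = wval E (psi x)) ->
      is_injective_hom ED EI (fun x => clique_word (fiber n x)).
Proof.
pose bounded (n : {ffun VD -> 'I_M.+1}) x : nat := n x.
pose T := {n : {ffun VD -> 'I_M.+1} & {ffun slot (bounded n) * slot (bounded n) -> bool}}.
pose EI (t : T) : rel (slot (bounded (tag t))) := fun i j => tagged t (i, j).
pose cliques (t : T) x : word (slot (bounded (tag t))) := clique_word (fiber _ x).
move=> /(discriminating_factorization EI cliques)[psi psi_hom psiP].
exists psi => // n EIn B nM BC prodB.
have [n' n'E] : exists n' : {ffun VD -> 'I_M.+1}, n = bounded n'.
  exists [ffun x => inord (n x)]; apply: funext => x.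
  by rewrite /bounded ffunE inordK // ltnS.
rewrite {n nM}n'E in EIn B BC prodB *.
pose t : T := existT _ n' [ffun p => EIn p.1 p.2].
have EIt : EI t = EIn by apply: funext => i; apply: funext => j; rewrite /EI ffunE.
by rewrite -EIt; apply: (psiP t B) => [|x]; rewrite ?EIt ?weval_clique_word.
Qed.

(* The elements over x are the factors of the image of x. *)
Lemma irreducible_factorization_hom (VD : finType) (ED : rel VD) (V : finType)
    (E : sgraph V) : th_ex_sub ED E ->
  exists (n : VD -> nat) (B : slot n -> raag E),
  [/\ forall i, irreducible (B i),
      forall i j, tag i = tag j -> i <> j -> commute (B i) (B j) /\ ~ coaxial (B i) (B j),
      forall i j, ED (tag i) (tag j) -> commute (B i) (B j)
    & is_injective_hom ED (commgraph B) (fun x => clique_word (fiber n x))].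
Proof.
move=> /(discriminating_fibers #|V|)[psi psi_hom psiP].
have [bs bsP] := choice (fun x => irreducible_factorization (wval E (psi x))).
pose n x := size (bs x); pose B (i : slot n) := nth 1 (bs (tag i)) (tagged i).
have Bbs i : B i \in bs (tag i) by rewrite mem_nth.
have Bcomm i h : commute (wval E (psi (tag i))) h -> commute (B i) h.
  by move=> psi_h; have [_ _ _ _] := bsP (tag i); apply.
exists n, B; split=> [i|i j ij Nij|i j ij|].
- by have [irr _ _ _ _] := bsP (tag i); apply: irr.
- case: i j ij Nij => [x i] [y j] /= xy; case: y / xy j => j Nij.
  split; first exact/Bcomm/commute_sym/Bcomm/commute_refl.
  have /eqP : i <> j :> nat by move=> /val_inj ij; apply: Nij; rewrite ij.
  have [_ _ _ /(pairwiseP 1) bsN _] := bsP x; rewrite neq_ltn => /orP[] ij.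
    by apply/asboolP/(bsN i j); rewrite // inE ltn_ord.
  by move/coaxial_sym; apply/asboolP/(bsN j i); rewrite // inE ltn_ord.
- apply/Bcomm/commute_sym/Bcomm; rewrite /commute -!wval_cat.
  by apply/wvalP/re_sym/psi_hom.
apply: (psiP n _ B) => [x|i j /commgraph_adjP[] //|x].
  by have [] := bsP x.
have [_ -> _ _ _] := bsP x.
by rewrite big_map (big_nth 1) /index_iota subn0 -val_enum_ord big_map.
Qed.

Lemma commgraph_vertex_embeds (I V : finType) (E : sgraph V) (B : I -> raag E) n
    (col : I -> 'I_n) : (forall i, irreducible (B i)) ->
  (forall i j, coaxial (B i) (B j) -> col i = col j -> i = j) ->
  vertex_embeds (commgraph B) (inflated E n).
Proof.
move=> irrB colB; have [x [k [c_inj cC]]] := irreducible_vertices irrB.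
pose c i := gen E (x i) ^ wval E (wrepr (k i)).
apply: (@eq_vertex_embeds _ _ (commgraph c)) => [i j|].
  by apply/commgraph_adjP/commgraph_adjP; rewrite /c !wreprK => -[ij /cC].
apply: (conj_vertices_embed (col := col)) => i j; rewrite !wreprK => /c_inj.
exact: colB.
Qed.

Section TameEmbedding.
Variables (VD I VL : choiceType) (ED : rel VD) (EI : sgraph I) (EL : rel VL).
Variable s : VD -> seq I.
Hypotheses (s_uniq : forall x, uniq (s x))
  (s_disjoint : forall x y i, i \in s x -> i \in s y -> x = y)
  (s_clique : forall x, {in s x &, forall i j, i != j -> EI i j})
  (s_joined : forall x y, ED x y -> {in s x & s y, forall i j, EI i j})
  (s_inj : is_injective_hom ED EI (fun x => clique_word (s x))).
Variables (f : I -> VL) (m : I -> nat) (k : I -> raag EL).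
Variable phi : UMagmaMorphism.type (raag EI) (raag EL).
Hypotheses (phi_inj : injective phi) (m_gt0 : forall i, 0 < m i)
  (phi_gen : forall i, phi (gen EI i) = (gen EL (f i) ^+ m i) ^ k i).

Definition conj_datum i : word VL * VL * int := (wrepr (k i), f i, Posz (m i)).
Definition tame_data x := [seq conj_datum i | i <- s x].
Definition tame_image x : word VL := flatten [seq yword d | d <- tame_data x].

Lemma wval_yword i : wval EL (yword (conj_datum i)) = phi (gen EI i).
Proof.
by rewrite /yword /conjw /wpow /= !wval_cat wval_winv wval_nseq wreprK phi_gen.
Qed.

Lemma wval_cword i : wval EL (cword (conj_datum i)) = gen EL (f i) ^ k i.
Proof. by rewrite /cword /conjw !wval_cat wval_winv wreprK. Qed.

Lemma wval_tame_image x : wval EL (tame_image x) = phi (wval EI (clique_word (s x))).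
Proof.
rewrite /tame_image /tame_data; elim: (s x) => [|i r IH] /=; first by rewrite gmulf1.
by rewrite wval_cat IH wval_yword wval_cons gmulfM.
Qed.

Lemma tame_image_hom : is_hom ED EL tame_image.
Proof.
move=> x y xy; apply/wvalP; rewrite !wval_cat !wval_tame_image.
apply/gmulf_commute/centrP/wval_closed => i; rewrite /supp /unzip1 -map_comp map_id => ix.
apply/centrP/commute_sym/centrP/wval_closed => j.
rewrite /supp /unzip1 -map_comp map_id => jy.
exact/centrP/commute_sym/gen_commute/(s_joined xy).
Qed.

Lemma tame_image_injective : is_injective_hom ED EL tame_image.
Proof.
move=> u w /wvalP; rewrite !wval_extend !(eq_weval wval_tame_image).
rewrite !(weval_morph (fun x => wval EI (clique_word (s x)))) -!wval_extend.
by move=> /phi_inj/wvalP/s_inj.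
Qed.

Lemma tnth_tame_data x (j : 'I_(size (tame_data x))) : exists i,
  [/\ i \in s x, tnth (in_tuple (tame_data x)) j = conj_datum i & index i (s x) = j].
Proof.
have sz : size (tame_data x) = size (s x) by rewrite size_map.
pose i := tnth (in_tuple (s x)) (cast_ord sz j).
have iE : i = nth i (s x) j by rewrite {1}/i (tnth_nth i).
exists i; split; first exact: mem_tnth.
  by rewrite (tnth_nth (conj_datum i)) /= (nth_map i) -?sz // -iE.
by rewrite iE index_uniq // -sz.
Qed.

Lemma conj_datum_inj i j : gen EL (f i) ^ k i = gen EL (f j) ^ k j -> i = j.
Proof.
move=> e; apply: (genX_inj_vertex (m := m j) (n := m i) (m_gt0 j)); apply: phi_inj.
by rewrite !gmulfXn !phi_gen !conjXg e expgnAC.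
Qed.

Lemma tame_image_is_tame : is_tame EL tame_image.
Proof.
exists tame_data; split=> [x|x j1 j2|x1 x2 j1 j2 ne]; first exact: re_refl.
  have [i1 [x_i1 -> _]] := tnth_tame_data j1; have [i2 [x_i2 -> _]] := tnth_tame_data j2.
  apply/wvalP; rewrite !(wval_cat _ (yword _) (yword _)) !wval_yword.
  apply: gmulf_commute; have [->|i12] := eqVneq i1 i2; first exact: commute_refl.
  exact/gen_commute/(s_clique x_i1).
have [i1 [x_i1 -> e1]] := tnth_tame_data j1; have [i2 [x_i2 -> e2]] := tnth_tame_data j2.
move=> /wvalP; rewrite !wval_cword => /conj_datum_inj i12.
rewrite i12 in x_i1 e1; have x12 := s_disjoint x_i1 x_i2.
by case: ne => //; rewrite -e1 -e2 x12.
Qed.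

Lemma tame_image_tame_embedding : tame_embedding ED EL tame_image.
Proof.
by split; [apply: tame_image_hom | apply: tame_image_injective | apply: tame_image_is_tame].
Qed.

End TameEmbedding.

Lemma vertex_embeds_tame_embedding (VD I VL : choiceType) (ED : rel VD) (EI : sgraph I)
    (EL : rel VL) (s : VD -> seq I) :
  (forall x, uniq (s x)) -> (forall x y i, i \in s x -> i \in s y -> x = y) ->
  (forall x, {in s x &, forall i j, i != j -> EI i j}) ->
  (forall x y, ED x y -> {in s x & s y, forall i j, EI i j}) ->
  is_injective_hom ED EI (fun x => clique_word (s x)) -> vertex_embeds EI EL ->
  exists phi, tame_embedding ED EL phi.
Proof.
move=> s_uniq s_disjoint s_clique s_joined s_inj [phi phi_inj /choice[f]].
move=> /choice[m] /choice[k fmkP]; exists (tame_image s f m k).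
apply: (tame_image_tame_embedding s_uniq s_disjoint s_clique s_joined s_inj phi_inj).
  by move=> i; have [] := fmkP i.
by move=> i; have [] := fmkP i.
Qed.

Theorem theorem4p12 (VD : finType) (ED : rel VD) (VG : finType) (EG : rel VG) :
  simplicial_graph ED -> simplicial_graph EG ->
  th_ex_sub ED EG ->
  exists phi : VD -> word (VG * 'I_#|VD|)%type,
    @tame_embedding VD ED _ (@inflation VG EG #|VD|) phi.
Proof.
move=> [_ ED_irr] [EG_sym EG_irr] sub; pose G := SGraph EG_sym EG_irr.
have [n [B [irrB sameB crossB B_inj]]] := @irreducible_factorization_hom _ _ _ G sub.
apply: (@vertex_embeds_tame_embedding _ _ _ _ (commgraph B) _ (fiber n)) => //.
- exact: fiber_uniq.
- by move=> x y i; rewrite !mem_fiber => /eqP -> /eqP.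
- move=> x i j; rewrite !mem_fiber => /eqP ix /eqP jx /eqP ij.
  by apply/commgraph_adjP; have [] := sameB i j (etrans ix (esym jx)) ij.
- move=> x y xy i j; rewrite !mem_fiber => /eqP ix /eqP jy; rewrite -{}ix -{}jy in xy.
  apply/commgraph_adjP; split; last exact: crossB.
  by move=> ij; rewrite ij ED_irr in xy.
apply: (@commgraph_vertex_embeds _ _ G _ _ (fun i => enum_rank (tag i))) => // i j ij.
by move=> /enum_rank_inj tij; apply: contrapT => /(sameB _ _ tij)[].
Qed.
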